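(* For every $n\ge2$ there exists a non-trivial (i.e. not all products zero) $n$-dimensional complex nilpotent Jordan algebra $\mu_0\in\mathcal N_n$ lying in all irreducible components of $\mathcal N_n$; further, the orbit $GL(n,\mathbb C)\cdot\mu_0$ is characterized as realizing the highest possible value of the energy $E_n$: the energy $E_n$ attains its maximum value, and it attains it exactly at the points of $GL(n,\mathbb C)\cdot\mu_0$. It follows that the projectivization $\mathbb P\mathcal N_n\subset\mathbb PV_n$ is connected for $n\ge2$.
   Context: Fix a Hermitian inner product $\langle\cdot,\cdot\rangle$ on $\mathbb C^n$. $V_n=S^2(\mathbb C^{n*})\otimes\mathbb C^n$ is the space of symmetric bilinear maps $\mu:\mathbb C^n\times\mathbb C^n\to\mathbb C^n$, identified with commutative (not necessarily associative) algebras $(\mathbb C^n,\mu)$. It carries the Hermitian product $\langle\mu,\nu\rangle=\sum_{i,j,k}\langle\mu(x_i,x_j),x_k\rangle\overline{\langle\nu(x_i,x_j),x_k\rangle}$, with $(x_i)$ any orthonormal basis. $GL(n,\mathbb C)$ acts on $V_n$ by $(g\cdot\mu)(a,b)=g\mu(g^{-1}a,g^{-1}b)$; $A\in\mathfrak{gl}(n,\mathbb C)$ acts by $(A\cdot\mu)(x,y)=A\mu(x,y)-\mu(Ax,y)-\mu(x,Ay)$. The moment matrix $M_\mu$ is the unique Hermitian endomorphism of $\mathbb C^n$ with $\mathrm{Tr}(M_\mu A)=\langle A\cdot\mu,\mu\rangle$ for all Hermitian $A$. For $\mu\in V_n\setminus\{0\}$: $m(\mu)=M_\mu/\|\mu\|^2$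 and the energy is $E_n(\mu)=\mathrm{Tr}(m(\mu)^2)$; thus $E_n:V_n\setminus\{0\}\to\mathbb R$. A Jordan algebra is a commutative algebra with $[L_a,L_{a^2}]=0$ for all $a$, where $L_a$ is multiplication by $a$. It is nilpotent if there is an integer $t$ such that every product of $t$ elements (in any bracketing) is zero. $\mathcal N_n\subset V_n$ is the Zariski-closed, $GL(n,\mathbb C)$-invariant, scaling-invariant set of nilpotent $n$-dimensional Jordan algebras, and $\mathbb P\mathcal N_n$ is the image of $\mathcal N_n\setminus\{0\}$ in $\mathbb PV_n$. *)

(* Defs.v *)
From HB Require Import structures.
From mathcomp Require Import all_boot all_order all_algebra.
From mathcomp Require Import complex.
From mathcomp Require Import mathcomp_extra boolp classical_sets functions reals.
From mathcomp Require Import topology.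

Set Implicit Arguments.
Unset Strict Implicit.
Unset Printing Implicit Defensive.

Import Order.TTheory GRing.Theory Num.Theory.
Local Open Scope classical_set_scope.
Local Open Scope ring_scope.
Local Open Scope complex_scope.

(* The topology whose closed sets are the common zero sets of subfamilies of
   [F], for [F] a multiplicative monoid of functions. *)
Section ZeroLoci.
Variables (K : idomainType) (X : Type) (F : set (X -> K)).

Definition zero_locus (S : set (X -> K)) : set X :=
  [set x | forall f, S f -> f x = 0].

Definition zopen (U : set X) : Prop :=
  exists2 S, S `<=` F & ~` U = zero_locus S.

Hypothesis F1 : F (fun=> 1).
Hypothesis FM : forall f g, F f -> F g -> F (fun x => f x * g x).

Lemma zopenT : zopen setT.
Proof.
exists [set fun=> 1]; first by move=> f ->.
rewrite setCT; apply/seteqP; split=> // x /(_ (fun=> 1) erefl)/eqP.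
by rewrite oner_eq0.
Qed.

Lemma zopenI : setI_closed zopen.
Proof.
move=> A B [S SF AS] [T TF BT].
exists [set h | exists f g, [/\ S f, T g & h = (fun x => f x * g x)]].
  by move=> _ [f [g [/SF Ff /TF Fg ->]]]; exact: FM.
rewrite setCI AS BT; apply/seteqP; split=> x.
  case=> zx _ [f [g [Sf Tg ->]]]; first by rewrite (zx f Sf) mul0r.
  by rewrite (zx g Tg) mulr0.
move=> zx; have [Sx|nSx] := pselect (zero_locus S x); first by left.
right=> g Tg; apply: contrapT => gx0; apply: nSx => f Sf.
have /eqP : f x * g x = 0 by apply: (zx (fun y => f y * g y)); exists f, g.
by rewrite mulf_eq0 => /orP[/eqP//|/eqP].
Qed.

Lemma zopen_bigU (I : Type) (f : I -> set X) :
  (forall i, zopen (f i)) -> zopen (\bigcup_i f i).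
Proof.
move=> fo.
exists [set g | F g /\ exists i, ~` f i `<=` [set x | g x = 0]].
  by move=> g [].
apply/seteqP; split=> x.
  by move=> nfx g [_ [i fi]]; apply: fi => fx; apply: nfx; exists i.
move=> zx [i _]; have [S SF fS] := fo i.
suff : (~` f i) x by [].
rewrite fS => g Sg; apply: zx; split; first exact: SF.
by exists i; rewrite fS => y; apply.
Qed.

End ZeroLoci.

Section PolynomialFunctions.
Variables (K : fieldType) (V : lmodType K).

(* The coordinate ring of [V]: the algebra of functions generated by the
   linear forms. *)
Inductive poly_fun : (V -> K) -> Prop :=
| poly_cst (c : K) : poly_fun (fun=> c)
| poly_lin (f : {scalar V}) : poly_fun f
| poly_add f g : poly_fun f -> poly_fun g -> poly_fun (fun v => f v + g v)
| poly_mul f g : poly_fun f -> poly_fun g -> poly_fun (fun v => f v * g v).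

Definition homog_poly_fun (f : V -> K) : Prop :=
  poly_fun f /\ exists d : nat, forall c v, f (c *: v) = c ^+ d * f v.

Lemma homog_poly_fun1 : homog_poly_fun (fun=> 1).
Proof.
by split; [exact: poly_cst | exists 0%N => c v; rewrite expr0 mul1r].
Qed.

Lemma homog_poly_funM f g :
  homog_poly_fun f -> homog_poly_fun g -> homog_poly_fun (fun v => f v * g v).
Proof.
move=> [pf [d fd]] [pg [e ge]]; split; first exact: poly_mul.
by exists (d + e)%N => c v; rewrite fd ge exprD mulrACA.
Qed.

End PolynomialFunctions.

(* [zariski V] is [V] with its Zariski topology. *)
Definition zariski (K : fieldType) (V : lmodType K) : Type := V.

Section Zariski.
Variables (K : fieldType) (V : lmodType K).

HB.instance Definition _ := Choice.on (zariski V).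
HB.instance Definition _ := @isOpenTopological.Build (zariski V)
  (zopen (@poly_fun K V : set (V -> K)))
  (zopenT (poly_cst V 1))
  (zopenI (@poly_mul K V))
  (@zopen_bigU K V (@poly_fun K V)).

End Zariski.

Section Irreducible.
Variable T : topologicalType.
Implicit Types X Y Z F G : set T.

Definition irreducible Z : Prop :=
  Z !=set0 /\ forall F G, closed F -> closed G ->
    Z `<=` F `|` G -> Z `<=` F \/ Z `<=` G.

Definition irreducible_component X Z : Prop :=
  [/\ Z `<=` X, irreducible Z &
      forall Y, Y `<=` X -> irreducible Y -> Z `<=` Y -> Y = Z].

End Irreducible.

Section Projectivization.
Variables (K : fieldType) (V : lmodType K).

Definition nonzero : Type := {v : V | v != 0}.
HB.instance Definition _ := Choice.on nonzero.

Definition proportional (u v : nonzero) : bool :=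
  `[< exists2 c : K, c != 0 & val u = c *: val v >].

Lemma proportional_refl : reflexive proportional.
Proof. by move=> u; apply/asboolP; exists 1; rewrite ?oner_eq0 ?scale1r. Qed.

Lemma proportional_sym : symmetric proportional.
Proof.
suff H u v : proportional u v -> proportional v u.
  by move=> u v; apply/idP/idP; exact: H.
move=> /asboolP[c c0 uv]; apply/asboolP; exists c^-1; first by rewrite invr_eq0.
by rewrite uv scalerA mulVf ?scale1r.
Qed.

Lemma proportional_trans : transitive proportional.
Proof.
move=> v u w /asboolP[c c0 uv] /asboolP[d d0 vw]; apply/asboolP.
by exists (c * d); rewrite ?mulf_neq0 // uv vw scalerA.
Qed.

Canonical proportional_equiv :=
  EquivRel proportional proportional_refl proportional_sym proportional_trans.

Definition proj : Type := {eq_quot proportional}%qT.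
HB.instance Definition _ := Quotient.on proj.
HB.instance Definition _ := Choice.on proj.

Definition projectivization (A : set V) : set proj :=
  [set \pi_proj%qT u | u in [set u : nonzero | A (val u)]].

(* Whether a homogeneous function vanishes at a point of the projective space
   does not depend on the representative, so the canonical one is used. *)
Definition proj_fun (f : V -> K) (p : proj) : K := f (val (repr p)).

Definition homog_proj_fun : set (proj -> K) :=
  [set proj_fun f | f in @homog_poly_fun K V].

Lemma homog_proj_fun1 : homog_proj_fun (fun=> 1).
Proof. by exists (fun=> 1) => //; exact: homog_poly_fun1. Qed.

Lemma homog_proj_funM f g : homog_proj_fun f -> homog_proj_fun g ->
  homog_proj_fun (fun p => f p * g p).
Proof.
move=> [f' hf <-] [g' hg <-].
by exists (fun v => f' v * g' v) => //; exact: homog_poly_funM.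
Qed.

End Projectivization.

(* [proj_zariski V] is the projective space of [V] with its Zariski topology. *)
Definition proj_zariski (K : fieldType) (V : lmodType K) : Type := proj V.

Section ProjZariski.
Variables (K : fieldType) (V : lmodType K).

HB.instance Definition _ := Choice.on (proj_zariski V).
HB.instance Definition _ := @isOpenTopological.Build (proj_zariski V)
  (zopen (@homog_proj_fun K V))
  (zopenT (homog_proj_fun1 V))
  (zopenI (@homog_proj_funM K V))
  (@zopen_bigU K (proj V) (@homog_proj_fun K V)).

End ProjZariski.

Section Algebras.
Variables (R : realType) (n : nat).
Local Notation C := R[i].
Local Notation Cn := 'cV[C]_n.

(* A bilinear product is stored as its left multiplication map
   [a |-> L_a : 'End(Cn)], so that the product of a and b is [mu a b]. *)
Local Notation bilin := 'Hom(Cn, 'End(Cn)).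

Definition commutative_product : {pred bilin} :=
  [pred mu : bilin | `[< forall a b : Cn, mu a b = mu b a >]].

Lemma commutative_submod : submod_closed commutative_product.
Proof.
split; first by apply/asboolP => a b; rewrite !zero_lfunE.
move=> c mu nu /asboolP hmu /asboolP hnu; apply/asboolP => a b.
by rewrite !(add_lfunE, scale_lfunE) hmu hnu.
Qed.

HB.instance Definition _ :=
  GRing.isSubmodClosed.Build C bilin commutative_product commutative_submod.

Record symbilin : Type := Symbilin {
  symbilin_val :> bilin;
  symbilinP : symbilin_val \in commutative_product }.

HB.instance Definition _ := [isSub of symbilin for symbilin_val].
HB.instance Definition _ := [Choice of symbilin by <:].
HB.instance Definition _ := [SubChoice_isSubLmodule of symbilin by <:].

Implicit Types (mu nu : symbilin) (a b : Cn) (A M : 'M[C]_n).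

Definition jordan mu : Prop :=
  forall a, (mu a \o mu (mu a a) = mu (mu a a) \o mu a)%VF.

(* [product_of mu t a]: [a] is a product of [t] elements, in some bracketing. *)
Inductive product_of mu : nat -> Cn -> Prop :=
| product1 a : product_of mu 1 a
| productM s t a b : product_of mu s a -> product_of mu t b ->
    product_of mu (s + t) (mu a b).

(* [0 < t] excludes [t = 0], for which the condition is vacuous. *)
Definition nilpotent mu : Prop :=
  exists2 t, (0 < t)%N & forall a, product_of mu t a -> a = 0.

Definition nilpotent_jordan : set symbilin :=
  [set mu | jordan mu /\ nilpotent mu].

Definition gl_act (g : 'M[C]_n) mu a b : Cn :=
  g *m mu (invmx g *m a) (invmx g *m b).

Definition gl_orbit mu : set symbilin :=
  [set nu : symbilin | exists2 g, g \in unitmx &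
     forall a b, nu a b = gl_act g mu a b].

Definition lie_act A mu a b : Cn :=
  A *m mu a b - mu (A *m a) b - mu a (A *m b).

Section Energy.
Variable dot : {dot Cn for Num.conj}.

Definition onb : n.-tuple Cn :=
  xget [tuple 0 | i < n] [set e : n.-tuple Cn | orthonormal dot e].

(* Stated for arbitrary binary maps so that it applies to [lie_act A mu]. *)
Definition prod_dot (p q : Cn -> Cn -> Cn) : C :=
  let x := tnth onb in
  \sum_i \sum_j \sum_k
    dot (p (x i) (x j)) (x k) * Num.conj (dot (q (x i) (x j)) (x k)).

Definition sqnorm mu : C := prod_dot (fun a b => mu a b) (fun a b => mu a b).

Definition norm mu : R := Num.sqrt (complex.Re (sqnorm mu)).

Definition hermitian_endo A : Prop :=
  forall a b, dot (A *m a) b = dot a (A *m b).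

Definition is_moment_matrix mu M : Prop :=
  hermitian_endo M /\
  forall A, hermitian_endo A ->
    \tr (M *m A) = prod_dot (lie_act A mu) (fun a b => mu a b).

Definition moment_matrix mu : 'M[C]_n := xget 0 [set M | is_moment_matrix mu M].

Definition normalized_moment mu : 'M[C]_n := (sqnorm mu)^-1 *: moment_matrix mu.

(* The trace is real, [normalized_moment mu] being Hermitian. *)
Definition energy mu : R :=
  complex.Re (\tr (normalized_moment mu *m normalized_moment mu)).

Definition norm_open (U : set (nonzero symbilin)) : Prop :=
  forall u, U u -> exists2 e : R,
    0 < e & forall v, norm (val v - val u) < e -> U v.

Lemma norm_openT : norm_open setT.
Proof. by move=> u _; exists 1. Qed.

Lemma norm_openI : setI_closed norm_open.
Proof.
move=> A B Ao Bo u [/Ao[e e0 eA] /Bo[d d0 dB]].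
exists (Num.min e d); first by rewrite lt_min e0.
by move=> v; rewrite lt_min => /andP[/eA ? /dB ?].
Qed.

Lemma norm_open_bigU (I : Type) (f : I -> set (nonzero symbilin)) :
  (forall i, norm_open (f i)) -> norm_open (\bigcup_i f i).
Proof.
move=> fo u [i _ /(fo i)[e e0 eU]].
by exists e => // v /eU ?; exists i.
Qed.

End Energy.

(* The nonzero vectors of [symbilin] with the topology of the norm, and the
   projective space with its classical topology, the quotient of the former. *)
Definition norm_nonzero (dot : {dot Cn for Num.conj}) : Type :=
  nonzero symbilin.

HB.instance Definition _ dot := Choice.on (norm_nonzero dot).
HB.instance Definition _ dot := @isOpenTopological.Build (norm_nonzero dot)
  (norm_open dot) (norm_openT dot) (@norm_openI dot) (@norm_open_bigU dot).

Definition proj_quot (dot : {dot Cn for Num.conj}) :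
  quotType (norm_nonzero dot) := proj symbilin.

Definition proj_classical (dot : {dot Cn for Num.conj}) : Type :=
  quotient_topology (proj_quot dot).

HB.instance Definition _ dot := Topological.on (proj_classical dot).

End Algebras.

(* Main.v *)
Require Import Defs.
From HB Require Import structures.
From mathcomp Require Import all_boot all_order all_algebra.
From mathcomp Require Import complex.
From mathcomp Require Import boolp classical_sets reals topology.
From mathcomp Require Import normed_module pseudometric_normed_Zmodule derive.
From mathcomp Require Import ring.

(* Let P, Q be the Gram matrices of the structure constants of mu along the
   output and along one input, in an orthonormal basis. The moment matrix is
   P - 2 Q^T, both P and Q have trace |mu|^2, and tr P^2, tr Q^2 <= |mu|^4 by
   Lagrange's identity, while tr PQ^T is the sum of the squared moduli of the
   triple products. Hence the energy is at most 5, with equality iff all 2x2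
   minors and all triple products vanish, i.e. mu (a, b) = phi a phi b u with
   phi u = 0; these tensors form a single orbit.

   If B A = s I then mu |-> A mu (B -, B -) preserves nilpotent Jordan algebras,
   even for s = 0. For a projection P, A = P + s (1 - P) and B = s P + (1 - P)
   give a polynomial family through the identity (s = 1), hence preserving each
   irreducible component; two degenerations s = 0 of this kind turn any nonzero
   nilpotent mu into a multiple of a prescribed phi ^ 2 (x) u. The same two
   curves connect all points of the projectivization to that of phi ^ 2 (x) u. *)

Set Implicit Arguments.
Unset Strict Implicit.
Unset Printing Implicit Defensive.

Import Order.TTheory GRing.Theory Num.Theory numFieldNormedType.Exports.
Local Open Scope classical_set_scope.
Local Open Scope ring_scope.

(** * The energy *)

Section Gram.
Variables (K : numClosedFieldType) (I J : finType).
Implicit Type f : I -> J -> K.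

Definition gram f (k l : I) : K := \sum_i f k i * (f l i)^*.

Lemma gram_conj f k l : (gram f k l)^* = gram f l k.
Proof.
by rewrite rmorph_sum; apply: eq_bigr => i _; rewrite rmorphM /= conjCK mulrC.
Qed.

Definition minor2 f k l i j : K := f k i * f l j - f k j * f l i.

(** Lagrange's identity: the squared modulus of a minor expands into four products of entries, and
    summing over [i] and [j] turns each into a product of two Gram entries. *)
Lemma sum_minor2 f :
  \sum_k \sum_l \sum_i \sum_j `|minor2 f k l i j| ^+ 2 =
  2 * ((\sum_k gram f k k) ^+ 2 - \sum_k \sum_l gram f k l * gram f l k).
Proof.
rewrite expr2 mulr_suml -sumrB mulr_sumr; apply: eq_bigr => k _.
rewrite mulr_sumr -sumrB mulr_sumr; apply: eq_bigr => l _.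
have step (a b c d : J -> K) : (\sum_i a i * b i) * (\sum_j c j * d j) =
    \sum_i \sum_j a i * b i * (c j * d j).
  by rewrite mulr_suml; apply: eq_bigr => i _; rewrite mulr_sumr.
transitivity (gram f k k * gram f l l + gram f l l * gram f k k
    - gram f k l * gram f l k - gram f l k * gram f k l); last by ring.
rewrite /gram !step -big_split /= -!sumrB; apply: eq_bigr => i _.
rewrite -big_split /= -!sumrB; apply: eq_bigr => j _.
by rewrite normCK /minor2 rmorphB !rmorphM; ring.
Qed.

End Gram.

Section EnergyGap.
Variables (K : numClosedFieldType) (n : nat) (c : 'I_n -> 'I_n -> 'I_n -> K).

Definition out_gram := gram (fun k (p : 'I_n * 'I_n) => c p.1 p.2 k).
Definition in_gram := gram (fun i (p : 'I_n * 'I_n) => c i p.1 p.2).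
Definition moment_coef k l : K := out_gram k l - 2 * in_gram l k.

(** For structure constants [c], the inner sum over [k] is a coordinate of a triple product (x_i
    x_j) x_a. Expanding its squared modulus introduces a second index [l], and summing over [p] and
    [q] first separates the two Gram entries. *)
Lemma sum_out_in_gram :
  \sum_k \sum_l out_gram k l * in_gram k l =
  \sum_(p : 'I_n * 'I_n) \sum_(q : 'I_n * 'I_n)
    `|\sum_k c p.1 p.2 k * c k q.1 q.2| ^+ 2.
Proof.
under eq_bigr => k _.
  under eq_bigr => l _.
    rewrite /out_gram /in_gram /gram mulr_suml.
    under eq_bigr => p _ do rewrite mulr_sumr.
    over.
  rewrite exchange_big.
  under eq_bigr => p _ do rewrite exchange_big.
  over.
rewrite exchange_big; apply: eq_bigr => p _; rewrite exchange_big.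
apply: eq_bigr => q _; rewrite normCK rmorph_sum mulr_suml.
apply: eq_bigr => k _; rewrite mulr_sumr; apply: eq_bigr => l _.
by rewrite rmorphM; ring.
Qed.

(** Here tr M^2 = tr P^2 - 4 tr PQ^T + 4 tr Q^2 while tr P = tr Q = N, so splitting 5 N^2 as N^2 + 4
    N^2 makes the gap a sum of two Lagrange defects and 4 tr PQ^T. The overall factor 2 is the one
    in [sum_minor2]. *)
Lemma energy_gap :
  2 * (5 * (\sum_i \sum_j \sum_k `|c i j k| ^+ 2) ^+ 2
       - \sum_k \sum_l moment_coef k l * moment_coef l k) =
  \sum_k \sum_l \sum_p \sum_q
     `|minor2 (fun k (p : 'I_n * 'I_n) => c p.1 p.2 k) k l p q| ^+ 2
  + 4 * (\sum_k \sum_l \sum_p \sum_q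
     `|minor2 (fun i (p : 'I_n * 'I_n) => c i p.1 p.2) k l p q| ^+ 2)
  + 8 * \sum_(p : 'I_n * 'I_n) \sum_(q : 'I_n * 'I_n)
    `|\sum_k c p.1 p.2 k * c k q.1 q.2| ^+ 2.
Proof.
rewrite !sum_minor2 -sum_out_in_gram -/out_gram -/in_gram.
have out_tr : \sum_k out_gram k k = \sum_i \sum_j \sum_k `|c i j k| ^+ 2.
  rewrite [RHS]pair_big [RHS]exchange_big /=; apply: eq_bigr => k _.
  by apply: eq_bigr => p _; rewrite normCK.
have in_tr : \sum_k in_gram k k = \sum_i \sum_j \sum_k `|c i j k| ^+ 2.
  apply: eq_bigr => i _; rewrite [RHS]pair_big /=.
  by apply: eq_bigr => p _; rewrite normCK.
rewrite out_tr in_tr.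
have -> : \sum_k \sum_l moment_coef k l * moment_coef l k =
    \sum_k \sum_l out_gram k l * out_gram l k
    - 4 * (\sum_k \sum_l out_gram k l * in_gram k l)
    + 4 * (\sum_k \sum_l in_gram k l * in_gram l k).
  transitivity (\sum_k \sum_l out_gram k l * out_gram l k
    - 2 * (\sum_k \sum_l out_gram k l * in_gram k l)
    - 2 * (\sum_k \sum_l out_gram l k * in_gram l k)
    + 4 * (\sum_k \sum_l in_gram k l * in_gram l k)).
    rewrite !mulr_sumr -!sumrB -big_split; apply: eq_bigr => k _ /=.
    rewrite !mulr_sumr -!sumrB -big_split; apply: eq_bigr => l _ /=.
    by rewrite /moment_coef; ring.
  rewrite [X in _ - _ - 2 * X]exchange_big /=; ring.
ring.
Qed.

End EnergyGap.

(** * Orthonormal bases for the given Hermitian product *)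

Section Orthonormal.
Variables (R : realType) (n : nat).
Local Notation C := R[i].
Local Notation Cn := 'cV[C]_n.
Variable dot : {dot Cn for Num.conj}.

(** Gram-Schmidt: fewer than [n] vectors do not span, so some [b] lies outside their span, and its
    component orthogonal to them can be normalized. This rules out the default value in the choice
    of [onb]. *)
Lemma exists_orthonormal : exists e : n.-tuple Cn, orthonormal dot e.
Proof.
suff H k : (k <= n)%N ->
    exists2 s : seq Cn, size s = k & orthonormal dot s.
  by have [s /eqP sz os] := H n (leqnn n); exists (Tuple sz).
elim: k => [_|k IHk ltkn]; first by exists [::].
have [s sz os] := IHk (ltnW ltkn).
have /subvPn[b _ bs] : ~~ ({:Cn} <= <<s>>)%VS.
  apply: contraL ltkn => /dimvS; rewrite dimvf /dim /= muln1 -leqNgt => le.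
  by rewrite -sz (leq_trans le) ?dim_span.
have [x xs [y [bxy _ ys]]] := orthogonal_split dot s b.
have y0 : y != 0 by apply: contra bs => /eqP y0; rewrite bxy y0 addr0.
pose r := sqrtC (dot y y).
have r0 : r != 0 by rewrite /r sqrt_dnorm_eq0.
exists (r^-1 *: y :: s); first by rewrite /= sz.
apply/orthonormalP; have [us so] := orthonormalP os.
have yE z : z \in s -> dot y z = 0 by move=> zs; have /orthoPl := ys; apply.
have nrm : dot (r^-1 *: y) (r^-1 *: y) = 1.
  rewrite dnormZ normrV ?unitfE // ger0_norm ?sqrt_dnorm_ge0 // exprVn sqrtCK.
  by rewrite mulVf // dnorm_eq0.
have nys : r^-1 *: y \notin s.
  apply/negP => yin; have := yE _ yin; rewrite linearZr_LR /= => /eqP.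
  rewrite mulf_eq0 dnorm_eq0 (negbTE y0) orbF conjC_eq0 invr_eq0.
  by rewrite (negbTE r0).
split; first by rewrite /= nys.
move=> a b'; rewrite !inE => /predU1P[->|ain] /predU1P[->|bin].
- by rewrite nrm eqxx.
- by rewrite linearZl_LR /= yE // mulr0 eq_sym (negbTE (memPn nys _ bin)).
- rewrite hermC /= expr0 mul1r linearZl_LR /= yE // mulr0 conjC0.
  by rewrite (negbTE (memPn nys _ ain)).
- exact: so.
Qed.

Lemma orthonormal_onb : orthonormal dot (onb dot).
Proof.
rewrite /onb; case: xgetP => [y _ //|no]; have [e oe] := exists_orthonormal.
by case: (no e).
Qed.

Local Notation e := (tnth (onb dot)).

Lemma dot_onb i j : dot (e i) (e j) = (i == j)%:R.
Proof.
have [ue oe] := orthonormalP orthonormal_onb.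
rewrite oe ?mem_tnth //; congr (nat_of_bool _)%:R.
by rewrite !(tnth_nth 0) nth_uniq ?size_tuple.
Qed.

Lemma onb_expand x : x = \sum_i dot x (e i) *: e i.
Proof.
have full : <<onb dot>>%VS = {:Cn}%VS.
  apply/eqP; rewrite eqEdim subvf dimvf /dim /= muln1.
  by have := orthonormal_free orthonormal_onb => /eqP ->; rewrite size_tuple.
apply/eqP; rewrite -subr_eq0 -(dnorm_eq0 dot).
set y := x - _.
have ye i : dot y (e i) = 0.
  rewrite /y linearBl linear_sumlz /= (bigD1 i) //= linearZl_LR /= dot_onb eqxx.
  rewrite mulr1 big1 ?addr0 ?subrr // => j ji.
  by rewrite linearZl_LR /= dot_onb (negbTE ji) mulr0.
suff dy0 z : dot y z = 0 by rewrite dy0.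
have : z \in <<onb dot>>%VS by rewrite full memvf.
move=> /coord_span ->; rewrite linear_sumr big1 // => i _.
by rewrite linearZr_LR /= -tnth_nth ye mulr0.
Qed.

Lemma dot_expand x y : dot x y = \sum_i dot x (e i) * (dot y (e i))^*.
Proof.
rewrite {1}(onb_expand x) linear_sumlz; apply: eq_bigr => i _.
by rewrite linearZl_LR /= [dot _ y]hermC /= expr0 mul1r.
Qed.

(** The standard basis need not be orthonormal for [dot]. These are the two mutually inverse changes
    of basis between it and [onb]. *)
Definition onb_mx : 'M[C]_n := \matrix_(i, j) e j i 0.
Definition onb_coord : 'M[C]_n :=
  \matrix_(i, j) dot (delta_mx j 0) (e i).

Lemma onb_coordE x i j : (onb_coord *m x) i j = dot x (e i).
Proof.
rewrite (ord1 j) mxE {2}[x]matrix_sum_delta linear_sumlz.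
apply: eq_bigr => k _; rewrite big_ord1 linearZl_LR /= mxE mulrC.
by [].
Qed.

Lemma onb_mxE i : onb_mx *m delta_mx i 0 = e i.
Proof. by rewrite -colE; apply/colP => k; rewrite !mxE. Qed.

Lemma onb_coordK : onb_coord *m onb_mx = 1%:M.
Proof.
apply/matrixP => i j.
have -> : (onb_coord *m onb_mx) i j = (col j (onb_coord *m onb_mx)) i 0.
  by rewrite [RHS]mxE.
by rewrite colE -mulmxA onb_mxE onb_coordE dot_onb mxE eq_sym.
Qed.

Lemma onb_mxK : onb_mx *m onb_coord = 1%:M.
Proof. exact: mulmx1C onb_coordK. Qed.

End Orthonormal.

Section Products.
Variables (R : realType) (n : nat).
Local Notation C := R[i].
Local Notation Cn := 'cV[C]_n.
Implicit Types (mu nu : symbilin R n) (a b : Cn) (phi : 'rV[C]_n).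

Lemma symbilinC mu a b : mu a b = mu b a.
Proof. by case: mu => mu /= /asboolP. Qed.

Lemma symbilin_ext mu nu : (forall a b, mu a b = nu a b) -> mu = nu.
Proof.
by move=> h; apply: val_inj; apply/lfunP => a; apply/lfunP => b; exact: h.
Qed.

Lemma symbilinD mu nu a b : (mu + nu) a b = mu a b + nu a b.
Proof. by rewrite !add_lfunE. Qed.

Lemma symbilinZ (k : C) mu a b : (k *: mu) a b = k *: mu a b.
Proof. by rewrite !scale_lfunE. Qed.

Lemma symbilin0 a b : (0 : symbilin R n) a b = 0.
Proof. by rewrite !zero_lfunE. Qed.

Definition ev phi a : C := (phi *m a) 0 0.

Lemma evD phi a b : ev phi (a + b) = ev phi a + ev phi b.
Proof. by rewrite /ev mulmxDr mxE. Qed.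

Lemma evZ phi k a : ev phi (k *: a) = k * ev phi a.
Proof. by rewrite /ev -scalemxAr mxE. Qed.

Definition square_tensor phi u mu : Prop :=
  forall a b, mu a b = (ev phi a * ev phi b) *: u.

End Products.

(** * Structure constants and the moment matrix in an orthonormal basis *)

Section Energy.
Variables (R : realType) (n : nat).
Local Notation C := R[i].
Local Notation Cn := 'cV[C]_n.
Variable dot : {dot Cn for Num.conj}.
Implicit Types (mu nu : symbilin R n) (a b : Cn) (A M : 'M[C]_n).
Local Notation e := (tnth (onb dot)).

Definition sconst mu i j k : C := dot (mu (e i) (e j)) (e k).

Lemma sconstC mu i j k : sconst mu i j k = sconst mu j i k.
Proof. by rewrite /sconst symbilinC. Qed.

Lemma symbilin_expand mu a b :
  mu a b = \sum_i \sum_j \sum_k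
    (dot a (e i) * dot b (e j) * sconst mu i j k) *: e k.
Proof.
rewrite {1}(onb_expand dot a) linear_sum sum_lfunE; apply: eq_bigr => i _.
rewrite {1}(onb_expand dot b) linear_sum; apply: eq_bigr => j _.
rewrite !linearZ /= scale_lfunE {1}(onb_expand dot (mu (e i) (e j))) !scaler_sumr.
by apply: eq_bigr => k _; rewrite !scalerA; congr (_ *: _); rewrite /sconst; ring.
Qed.

Lemma sqnormE mu :
  sqnorm dot mu = \sum_i \sum_j \sum_k `|sconst mu i j k| ^+ 2.
Proof.
by do 3![apply: eq_bigr => ? _]; rewrite normCK.
Qed.

Lemma sconst_eq0 mu : (forall i j k, sconst mu i j k = 0) -> mu = 0.
Proof.
move=> h; apply: symbilin_ext => a b; rewrite symbilin0 symbilin_expand.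
by do 3![rewrite big1 // => ? _]; rewrite h mulr0 scale0r.
Qed.

Lemma sqnorm_gt0 mu : mu != 0 -> 0 < sqnorm dot mu.
Proof.
move=> mu0; rewrite sqnormE lt_def; apply/andP; split; last first.
  by do 3![apply: sumr_ge0 => ? _]; rewrite exprn_ge0.
apply: contra mu0 => /eqP h; apply/eqP/sconst_eq0 => i j k.
have ge0 : forall i j k, 0 <= `|sconst mu i j k| ^+ 2 by move=> *; rewrite exprn_ge0.
move: h => /psumr_eq0P-/(_ (fun i _ =>
  sumr_ge0 _ (fun j _ => sumr_ge0 _ (fun k _ => ge0 i j k))) i isT).
move=> /psumr_eq0P-/(_ (fun j _ => sumr_ge0 _ (fun k _ => ge0 i j k)) j isT).
move=> /psumr_eq0P-/(_ (fun k _ => ge0 i j k) k isT).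
by move/eqP; rewrite expf_eq0 normr_eq0 => /andP[_ /eqP].
Qed.

Definition onb_rep A : 'M[C]_n := onb_coord dot *m A *m onb_mx dot.

Lemma onb_repE A i j : onb_rep A i j = dot (A *m e j) (e i).
Proof.
have -> : onb_rep A i j = col j (onb_rep A) i 0 by rewrite [RHS]mxE.
by rewrite colE -!mulmxA onb_mxE onb_coordE.
Qed.

Lemma onb_repK A : onb_mx dot *m onb_rep A *m onb_coord dot = A.
Proof. by rewrite !mulmxA onb_mxK mul1mx -mulmxA onb_mxK mulmx1. Qed.

Lemma hermitian_endoP A :
  hermitian_endo dot A <-> forall i j, (onb_rep A i j)^* = onb_rep A j i.
Proof.
split=> [hA i j|hA a b].
  by rewrite !onb_repE hA [RHS]hermC /= expr0 mul1r.
have coordA x i : dot (A *m x) (e i) = \sum_j onb_rep A i j * dot x (e j).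
  rewrite -(onb_coordE _ _ _ 0) -{1}[x]mul1mx -(onb_mxK dot) !mulmxA -/(onb_rep A).
  by rewrite -mulmxA mxE; apply: eq_bigr => j _; rewrite onb_coordE.
rewrite !(dot_expand _ _ (_ *m _)) [LHS]dot_expand.
under eq_bigr do rewrite coordA mulr_suml.
under [RHS]eq_bigr do rewrite coordA rmorph_sum mulr_sumr.
rewrite exchange_big; apply: eq_bigr => i _; apply: eq_bigr => j _.
by rewrite rmorphM /= hA; ring.
Qed.

Definition moment_rep mu : 'M[C]_n :=
  \matrix_(k, l) moment_coef (sconst mu) k l.

(** Of the three terms of A.mu, the one acting on the output pairs with mu to give tr (P A). The two
    acting on the inputs coincide by commutativity, and each contributes -tr (Q^T A). *)
Lemma prod_dot_lie_act A mu :
  prod_dot dot (lie_act A mu) (fun a b => mu a b) =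
  \tr (moment_rep mu *m onb_rep A).
Proof.
have coef i j k : dot (lie_act A mu (e i) (e j)) (e k) =
    \sum_l (onb_rep A k l * sconst mu i j l - onb_rep A l i * sconst mu l j k
            - onb_rep A l j * sconst mu l i k).
  have act x : A *m x = \sum_l dot x (e l) *: (A *m e l).
    rewrite {1}(onb_expand dot x) mulmx_sumr.
    by apply: eq_bigr => l _; rewrite -scalemxAr.
  have left i' j' : dot (mu (A *m e i') (e j')) (e k) =
      \sum_l onb_rep A l i' * sconst mu l j' k.
    rewrite {1}(onb_expand dot (A *m e i')) linear_sum sum_lfunE linear_sumlz.
    apply: eq_bigr => l _.
    by rewrite linearZ /= scale_lfunE linearZl_LR /= -onb_repE.
  rewrite /lie_act !linearBl /= (symbilinC mu (e i) (_ *m _)) !left act linear_sumlz /=.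
  rewrite !sumrB; congr (_ - _ - _); apply: eq_bigr => l _.
  by rewrite linearZl_LR /= onb_repE mulrC.
rewrite /prod_dot; under eq_bigr do under eq_bigr do under eq_bigr do
  rewrite coef -/(sconst mu _ _ _).
rewrite /mxtrace.
transitivity (\sum_k \sum_l out_gram (sconst mu) k l * onb_rep A l k
   - 2 * \sum_k \sum_l in_gram (sconst mu) l k * onb_rep A l k).
  have split3 (F G H : 'I_n -> 'I_n -> 'I_n -> 'I_n -> C) :
      \sum_i \sum_j \sum_k (\sum_l (F i j k l - G i j k l - H i j k l)) * (sconst mu i j k)^*
    = \sum_i \sum_j \sum_k \sum_l F i j k l * (sconst mu i j k)^*
    - \sum_i \sum_j \sum_k \sum_l G i j k l * (sconst mu i j k)^*
    - \sum_i \sum_j \sum_k \sum_l H i j k l * (sconst mu i j k)^*.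
    do 3![rewrite -!sumrB; apply: eq_bigr => ? _].
    by rewrite !sumrB !mulrBl !mulr_suml.
  rewrite split3 [X in _ - X]exchange_big /=.
  have -> : \sum_j \sum_i \sum_k \sum_l onb_rep A l j * sconst mu l i k
     * (sconst mu i j k)^* =
     \sum_i \sum_j \sum_k \sum_l onb_rep A l i * sconst mu l j k
     * (sconst mu i j k)^*.
    by do 4![apply: eq_bigr => ? _]; rewrite [sconst mu _ _ _ in X in _ = _ * X]sconstC.
  rewrite -addrA -opprD; congr (_ - _).
    rewrite [RHS]exchange_big /=.
    rewrite pair_big /= exchange_big; apply: eq_bigr => k _ /=.
    rewrite exchange_big; apply: eq_bigr => l _ /=.
    by rewrite /out_gram /gram mulr_suml; apply: eq_bigr => p _; ring.
  rewrite mulr_natl -mulr2n; congr (_ *+ 2).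
  apply: eq_bigr => i _; rewrite pair_big /= exchange_big; apply: eq_bigr => l _ /=.
  by rewrite /in_gram /gram mulr_suml; apply: eq_bigr => p _; ring.
rewrite mulr_sumr -sumrB; apply: eq_bigr => k _.
rewrite mulr_sumr -sumrB mxE; apply: eq_bigr => l _.
by rewrite [moment_rep _ _ _]mxE /moment_coef; ring.
Qed.

Lemma moment_matrixE mu :
  moment_matrix dot mu = onb_mx dot *m moment_rep mu *m onb_coord dot.
Proof.
set M := _ *m _.
have repM : onb_rep M = moment_rep mu.
  by rewrite /onb_rep /M !mulmxA onb_coordK mul1mx -mulmxA onb_coordK mulmx1.
have trM A B : \tr (A *m B) = \tr (onb_rep A *m onb_rep B).
  rewrite -{1}(onb_repK A) -!mulmxA mxtrace_mulC -!mulmxA.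
  by rewrite (mulmxA _ B) -/(onb_rep B) mxtrace_mulC.
have Mmom : is_moment_matrix dot mu M.
  split=> [|A _]; last by rewrite prod_dot_lie_act trM repM.
  apply/hermitian_endoP => i j; rewrite repM !mxE /moment_coef rmorphB rmorphM.
  by rewrite /= /out_gram /in_gram !gram_conj conjC_nat.
rewrite /moment_matrix; case: xgetP => [N _ [Nh Nt]|/(_ M)//].
have [Mh Mt] := Mmom; apply/eqP; rewrite -subr_eq0; apply/eqP.
(* Uniqueness: [N] and [M] have the same trace against every Hermitian endomorphism, in particular
   against their difference [D], so tr D^2 = 0. As [D] is Hermitian, this trace is the sum of the
   squared moduli of its entries in the orthonormal basis. *)
pose D := N - M; have Dh : hermitian_endo dot D.
  by move=> a b; rewrite !mulmxBl linearBl linearBr /= Nh Mh.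
have /eqP : \tr (D *m D) = 0 by rewrite {1}/D mulmxBl raddfB /= Nt // Mt // subrr.
rewrite trM; have /hermitian_endoP Dc := Dh.
have -> : \tr (onb_rep D *m onb_rep D) =
    \sum_i \sum_j `|onb_rep D i j| ^+ 2.
  apply: eq_bigr => i _; rewrite mxE; apply: eq_bigr => j _.
  by rewrite normCK Dc.
have ge0 i j : 0 <= `|onb_rep D i j| ^+ 2 by rewrite exprn_ge0.
move=> /eqP h; rewrite -/D -[D]onb_repK (_ : onb_rep D = 0) ?mulmx0 ?mul0mx //.
apply/matrixP => i j; rewrite [RHS]mxE.
move: h => /psumr_eq0P-/(_ (fun i _ => sumr_ge0 _ (fun j _ => ge0 i j)) i isT).
move=> /psumr_eq0P-/(_ (fun j _ => ge0 i j) j isT).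
by move/eqP; rewrite expf_eq0 normr_eq0 => /andP[_ /eqP].
Qed.

End Energy.

Section SumsOfSquares.
Variables (K : numDomainType) (P Q : finType).

Lemma sum2_sqr_ge0 (F : P -> Q -> K) : 0 <= \sum_p \sum_q `|F p q| ^+ 2.
Proof. by do 2![apply: sumr_ge0 => ? _]; rewrite exprn_ge0. Qed.

Lemma sum2_sqr_eq0 (F : P -> Q -> K) :
  \sum_p \sum_q `|F p q| ^+ 2 = 0 <-> forall p q, F p q = 0.
Proof.
split=> [h p q|h]; last first.
  by do 2![rewrite big1 // => ? _]; rewrite h normr0 expr0n.
have ge0 (x : K) : 0 <= `|x| ^+ 2 by rewrite exprn_ge0.
rewrite pair_big /= in h.
have /(_ (p, q))/= := psumr_eq0P (fun r _ => ge0 (F r.1 r.2)) h.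
by move=> /(_ isT)/eqP; rewrite expf_eq0 normr_eq0 => /andP[_ /eqP].
Qed.

End SumsOfSquares.

Section FourfoldSums.
Variables (K : numDomainType) (I J P Q : finType).

Lemma sum4_sqr_ge0 (F : I -> J -> P -> Q -> K) :
  0 <= \sum_i \sum_j \sum_p \sum_q `|F i j p q| ^+ 2.
Proof. by do 2![apply: sumr_ge0 => ? _]; apply: sum2_sqr_ge0. Qed.

Lemma sum4_sqr_eq0 (F : I -> J -> P -> Q -> K) :
  \sum_i \sum_j \sum_p \sum_q `|F i j p q| ^+ 2 = 0 <->
  forall i j p q, F i j p q = 0.
Proof.
rewrite pair_big pair_big /=.
split=> [h i j p q|h]; last by apply/sum2_sqr_eq0 => -[[i j] p] q; apply: h.
by have /sum2_sqr_eq0/(_ (i, j, p) q) := h.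
Qed.

End FourfoldSums.

(** * The bound on the energy and the case of equality *)

Section EnergyMax.
Variables (R : realType) (n : nat).
Local Notation C := R[i].
Local Notation Cn := 'cV[C]_n.
Variable dot : {dot Cn for Num.conj}.
Implicit Types (mu nu : symbilin R n) (a b : Cn) (phi : 'rV[C]_n).
Local Notation e := (tnth (onb dot)).
Local Notation sconst := (sconst dot).

(** The distance of the energy from 5, cleared of the denominator |mu|^4. *)
Definition defect mu : C :=
  5 * sqnorm dot mu ^+ 2 -
  \sum_k \sum_l moment_coef (sconst mu) k l * moment_coef (sconst mu) l k.

Lemma energyE mu : mu != 0 ->
  energy dot mu = 5 - complex.Re (defect mu / sqnorm dot mu ^+ 2).
Proof.
move=> /(sqnorm_gt0 dot)/lt0r_neq0 N0.
rewrite /energy /normalized_moment -scalemxAl -scalemxAr !mxtraceZ.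
have -> : \tr (moment_matrix dot mu *m moment_matrix dot mu) =
    5 * sqnorm dot mu ^+ 2 - defect mu.
  rewrite moment_matrixE !mulmxA mxtrace_mulC !mulmxA onb_coordK mul1mx.
  rewrite -(mulmxA (moment_rep _ _)) onb_coordK mulmx1 /defect opprB addrC subrK.
  by apply: eq_bigr => k _; rewrite mxE; apply: eq_bigr => l _; rewrite !mxE.
have -> : (sqnorm dot mu)^-1 * ((sqnorm dot mu)^-1 *
    (5 * sqnorm dot mu ^+ 2 - defect mu)) = 5 - defect mu / sqnorm dot mu ^+ 2.
  by rewrite mulrA -invfM -expr2 mulrBr mulrCA mulVf ?expf_neq0 // mulr1 mulrC.
by rewrite raddfB.
Qed.

Lemma double_defect mu : 2 * defect mu =
  \sum_k \sum_l \sum_p \sum_q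
     `|minor2 (fun k (p : 'I_n * 'I_n) => sconst mu p.1 p.2 k) k l p q| ^+ 2
  + 4 * (\sum_k \sum_l \sum_p \sum_q
     `|minor2 (fun i (p : 'I_n * 'I_n) => sconst mu i p.1 p.2) k l p q| ^+ 2)
  + 8 * \sum_(p : 'I_n * 'I_n) \sum_(q : 'I_n * 'I_n)
    `|\sum_k sconst mu p.1 p.2 k * sconst mu k q.1 q.2| ^+ 2.
Proof. by rewrite -energy_gap -sqnormE. Qed.

Lemma defect_ge0 mu : 0 <= defect mu.
Proof.
rewrite -(pmulr_rge0 _ (ltr0n _ 2)) double_defect.
by rewrite !addr_ge0 ?mulr_ge0 ?ler0n ?sum4_sqr_ge0 ?sum2_sqr_ge0.
Qed.

Lemma defect_eq0 mu : defect mu = 0 <->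
  [/\ forall i j k i' j' k', sconst mu i j k * sconst mu i' j' k' =
                             sconst mu i' j' k * sconst mu i j k',
      forall i j k i' j' k', sconst mu i j k * sconst mu i' j' k' =
                             sconst mu i j' k' * sconst mu i' j k &
      forall i j p q, \sum_k sconst mu i j k * sconst mu k p q = 0].
Proof.
have -> : defect mu = 0 <-> 2 * defect mu = 0.
  by split=> [->|/eqP]; rewrite ?mulr0 // mulf_eq0 pnatr_eq0 => /eqP.
rewrite double_defect; split=> [/eqP|[mo mi tr]]; last first.
  rewrite (sum4_sqr_eq0 _).2 => [|k l p q]; last by rewrite /minor2 mo subrr.
  rewrite (sum4_sqr_eq0 _).2 => [|k l p q]; last by rewrite /minor2 mi subrr.
  by rewrite (sum2_sqr_eq0 _).2 => [|p q]; rewrite ?tr // !mulr0 !addr0.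
rewrite paddr_eq0 ?addr_ge0 ?mulr_ge0 ?ler0n ?sum4_sqr_ge0 ?sum2_sqr_ge0 //.
rewrite paddr_eq0 ?mulr_ge0 ?ler0n ?sum4_sqr_ge0 // !mulf_eq0 !pnatr_eq0 /=.
move=> /andP[/andP[/eqP/sum4_sqr_eq0 mo /eqP/sum4_sqr_eq0 mi] /eqP/sum2_sqr_eq0 tr].
split=> [i j k i' j' k'|i j k i' j' k'|i j p q]; last exact: (tr (i, j) (p, q)).
  by have /eqP := mo k k' (i, j) (i', j'); rewrite subr_eq0 /= => /eqP.
by have /eqP := mi i i' (j, k) (j', k'); rewrite subr_eq0 /= => /eqP.
Qed.

(* If [c_abd != 0] is a structure constant, the vanishing of the minors gives
   [c_ijk = c_ibd c_jbd c_aad c_abk / c_abd ^ 3]. *)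
Lemma defect_eq0_square mu : mu != 0 -> defect mu = 0 ->
  exists phi u, ev phi u = 0 /\ square_tensor phi u mu.
Proof.
move=> mu0 /defect_eq0[mo mi tr].
have [i0 [j0 [k0 c0]]] : exists i j k, sconst mu i j k != 0.
  apply: contrapT => h; move/eqP: mu0; apply; apply: (@sconst_eq0 _ _ dot).
  by move=> i j k; apply/eqP; apply: contrapT => /negP c0; apply: h; exists i, j, k.
pose c := sconst mu; rewrite -/c in mo mi tr c0.
have cE i j k : c i j k =
    c i j0 k0 * c j j0 k0 * (c i0 i0 k0 / c i0 j0 k0 ^+ 3 * c i0 j0 k).
  have solve x y z : x * c i0 j0 k0 = y * z -> x = y * z / c i0 j0 k0.
    by move=> <-; rewrite mulfK.
  have -> := solve _ _ _ (mo i j k i0 j0 k0).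
  have -> := solve _ _ _ (mi i j k0 i0 j0 k0).
  rewrite [c i0 j k0]sconstC -/(c j i0 k0).
  have -> := solve _ _ _ (mi j i0 k0 i0 j0 k0).
  by field.
pose phi : 'rV[C]_n := (\row_i c i j0 k0) *m onb_coord dot.
have phiE x : ev phi x = \sum_i dot x (e i) * c i j0 k0.
  rewrite /ev /phi -mulmxA mxE; apply: eq_bigr => i _.
  by rewrite onb_coordE mxE mulrC.
pose u := \sum_k (c i0 i0 k0 / c i0 j0 k0 ^+ 3 * c i0 j0 k) *: e k.
exists phi, u; split; last first.
  move=> a b; rewrite (symbilin_expand dot) !phiE /u mulr_suml scaler_suml.
  apply: eq_bigr => i _; rewrite mulr_sumr scaler_suml; apply: eq_bigr => j _.
  rewrite scaler_sumr; apply: eq_bigr => k _; rewrite scalerA -/c cE.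
  by congr (_ *: _); ring.
rewrite /ev /u mulmx_sumr summxE.
(* Up to the scalar in [u], the value phi(u) is the coordinate along e_k0 of the triple product
   (e_i0 e_j0) e_j0, which vanishes. *)
transitivity (c i0 i0 k0 / c i0 j0 k0 ^+ 3 *
    \sum_k c i0 j0 k * c k j0 k0); last by rewrite tr mulr0.
rewrite mulr_sumr; apply: eq_bigr => k _; rewrite -[LHS]/(ev _ _) evZ phiE.
rewrite (bigD1 k) //= dot_onb eqxx mul1r big1 ?addr0 ?mulrA // => i ik.
by rewrite dot_onb eq_sym (negbTE ik) mul0r.
Qed.

Lemma square_defect_eq0 mu phi u :
  ev phi u = 0 -> square_tensor phi u mu -> defect mu = 0.
Proof.
move=> phiu sq; apply/defect_eq0.
have cE i j k : sconst mu i j k = ev phi (e i) * ev phi (e j) * dot u (e k).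
  by rewrite /sconst sq linearZl_LR.
split=> [? ? ? ? ? ?|? ? ? ? ? ?|i j p q]; rewrite ?cE; try ring.
(* Only two factors depend on [k], and summing them reassembles phi(u) from the expansion of [u] in
   the basis. *)
transitivity (ev phi (e i) * ev phi (e j) * ev phi (e p) * dot u (e q) * ev phi u).
  rewrite [in X in _ = _ * X](onb_expand dot u) {4}/ev mulmx_sumr summxE mulr_sumr.
  apply: eq_bigr => k _; rewrite !cE -[(phi *m (_ *: _)) 0 0]/(ev _ _) evZ; ring.
by rewrite phiu mulr0.
Qed.

Lemma energy_le5 mu : mu != 0 -> energy dot mu <= 5.
Proof.
move=> mu0; rewrite energyE // gerBl.
suff : 0 <= defect mu / sqnorm dot mu ^+ 2.
  by rewrite lecE => /andP[].
by rewrite divr_ge0 ?defect_ge0 ?exprn_ge0 // ltW // sqnorm_gt0.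
Qed.

Lemma energy_eq5 mu : mu != 0 -> energy dot mu = 5 <-> defect mu = 0.
Proof.
move=> mu0; rewrite energyE //; split=> [|->]; last by rewrite mul0r /= subr0.
have N0 := lt0r_neq0 (sqnorm_gt0 dot mu0).
have : 0 <= defect mu / sqnorm dot mu ^+ 2.
  by rewrite divr_ge0 ?defect_ge0 ?exprn_ge0 // ltW // sqnorm_gt0.
(* The energy only sees a real part; nonnegativity in the complex order supplies the vanishing of
   the imaginary part. *)
rewrite lecE => /andP[/eqP im _] /eqP; rewrite -subr_eq0 addrAC subrr sub0r.
rewrite oppr_eq0 => /eqP re; have /eqP : defect mu / sqnorm dot mu ^+ 2 = 0.
  by apply/eqP; rewrite eq_complex re im !eqxx.
by rewrite mulf_eq0 invr_eq0 expf_eq0 (negbTE N0) andbF orbF => /eqP.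
Qed.

End EnergyMax.

(** * Rank-one products and degenerations *)

Section SymmetricTensors.
Variables (R : realType) (n : nat).
Local Notation C := R[i].
Local Notation Cn := 'cV[C]_n.
Implicit Types (mu nu : symbilin R n) (a b u : Cn) (phi psi : 'rV[C]_n).

Definition sym2_fun phi psi u a b : Cn :=
  (ev phi a * ev psi b + ev psi a * ev phi b) *: u.

Lemma sym2_fun_linear phi psi u a : linear (sym2_fun phi psi u a).
Proof.
move=> k x y; rewrite /sym2_fun !evD !evZ scalerA -scalerDl.
by congr (_ *: _); ring.
Qed.

HB.instance Definition _ phi psi u a :=
  GRing.isLinear.Build C Cn Cn *:%R (sym2_fun phi psi u a)
    (sym2_fun_linear phi psi u a).

Definition sym2_lmul phi psi u a : 'End(Cn) := linfun (sym2_fun phi psi u a).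

Lemma sym2_lmul_linear phi psi u : linear (sym2_lmul phi psi u).
Proof.
move=> k x y; apply/lfunP => b.
rewrite add_lfunE scale_lfunE !lfunE /= /sym2_fun !evD !evZ scalerA -scalerDl.
by congr (_ *: _); ring.
Qed.

HB.instance Definition _ phi psi u :=
  GRing.isLinear.Build C Cn 'End(Cn) *:%R (sym2_lmul phi psi u)
    (sym2_lmul_linear phi psi u).

Lemma sym2_commutative phi psi u :
  linfun (sym2_lmul phi psi u) \in @commutative_product R n.
Proof.
by apply/asboolP => a b; rewrite !lfunE /= /sym2_fun; congr (_ *: _); ring.
Qed.

Definition sym2 phi psi u : symbilin R n := Symbilin (sym2_commutative phi psi u).

Lemma sym2E phi psi u a b : sym2 phi psi u a b = sym2_fun phi psi u a b.
Proof. by rewrite !lfunE. Qed.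

(** The factor 1/2 compensates for the two equal terms of [sym2] on the diagonal. *)
Definition square phi u : symbilin R n := 2^-1 *: sym2 phi phi u.

Lemma squareE phi u : square_tensor phi u (square phi u).
Proof.
move=> a b; rewrite /square symbilinZ sym2E /sym2_fun scalerA.
by congr (_ *: _); field.
Qed.

Lemma square_tensor_inj phi u mu : square_tensor phi u mu -> mu = square phi u.
Proof. by move=> sq; apply: symbilin_ext => a b; rewrite sq squareE. Qed.

Lemma symbilin_sum (I : Type) (r : seq I) (F : I -> symbilin R n) a b :
  (\sum_(i <- r) F i) a b = \sum_(i <- r) F i a b.
Proof.
by elim: r => [|i r IHr]; rewrite ?big_nil ?big_cons ?symbilin0 ?symbilinD ?IHr.
Qed.

(** Summing symmetrized tensors makes commutativity automatic for any table [g]; the products of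
    basis vectors are those of [g] when [g] is symmetric, each pair being counted in both orders. *)
Definition of_table (g : 'I_n -> 'I_n -> Cn) : symbilin R n :=
  2^-1 *: \sum_i \sum_j sym2 (delta_mx 0 i) (delta_mx 0 j) (g i j).

Lemma ev_delta i a : ev (delta_mx 0 i) a = a i 0.
Proof. by rewrite /ev -rowE mxE. Qed.

Lemma cV_expand a : a = \sum_i a i 0 *: delta_mx i 0.
Proof.
by rewrite {1}[a]matrix_sum_delta; apply: eq_bigr => i _; rewrite big_ord1.
Qed.

Lemma of_tableE g a b : (forall i j, g i j = g j i) ->
  of_table g a b = \sum_i \sum_j (a i 0 * b j 0) *: g i j.
Proof.
move=> gC; rewrite /of_table symbilinZ symbilin_sum.
under eq_bigr do rewrite symbilin_sum.
under eq_bigr do under eq_bigr do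
  rewrite sym2E /sym2_fun !ev_delta scalerDl.
under eq_bigr do rewrite big_split /=.
rewrite big_split /= [X in _ + X]exchange_big /=.
have -> : \sum_j \sum_i (a j 0 * b i 0) *: g i j =
          \sum_i \sum_j (a i 0 * b j 0) *: g i j.
  by apply: eq_bigr => i _; apply: eq_bigr => j _; rewrite gC.
by rewrite scalerDr -scalerDl (_ : _ + _ = 1) ?scale1r //; field.
Qed.

(** With [B] inverse to [A] this is the action of [A]. Keeping the two matrices independent allows
    singular ones, hence degenerations. *)
Definition pull_fun (A B : 'M[C]_n) mu a b : Cn := A *m mu (B *m a) (B *m b).

(* Locked, lest unification match [pull] against the scaling in [of_table]. *)
Definition pull (A B : 'M[C]_n) mu : symbilin R n :=
  locked (of_table (fun i j => pull_fun A B mu (delta_mx i 0) (delta_mx j 0))).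

Lemma pullE A B mu a b : pull A B mu a b = pull_fun A B mu a b.
Proof.
rewrite /pull -lock of_tableE => [|i j]; last by rewrite /pull_fun symbilinC.
rewrite [in RHS](cV_expand a) [in RHS](cV_expand b) /pull_fun.
rewrite !mulmx_sumr (linear_sum (symbilin_val mu)) sum_lfunE mulmx_sumr; apply: eq_bigr => i _.
rewrite linear_sum mulmx_sumr; apply: eq_bigr => j _.
by rewrite -!scalemxAr !linearZ /= scale_lfunE -!scalemxAr scalerA mulrC.
Qed.

Lemma pull_linear A B : linear (pull A B).
Proof.
move=> k mu nu; apply: symbilin_ext => a b.
rewrite symbilinD symbilinZ !pullE /pull_fun symbilinD symbilinZ mulmxDr.
by rewrite scalemxAr.
Qed.

HB.instance Definition _ A B :=
  GRing.isLinear.Build C (symbilin R n) (symbilin R n) *:%R (pull A B)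
    (pull_linear A B).

Lemma pull1 mu : pull 1%:M 1%:M mu = mu.
Proof.
by apply: symbilin_ext => a b; rewrite pullE /pull_fun !mul1mx.
Qed.

Lemma pull_pull A B A' B' mu :
  pull A' B' (pull A B mu) = pull (A' *m A) (B *m B') mu.
Proof.
by apply: symbilin_ext => a b; rewrite !pullE /pull_fun pullE /pull_fun !mulmxA.
Qed.

Section Pull.
Variables (A B : 'M[C]_n) (s : C).
Hypothesis BA : B *m A = s%:M.
Variable mu : symbilin R n.

(** Up to the factor [s], the matrix [B] is a homomorphism from the pulled-back algebra to [mu];
    identities are transferred along it. *)
Lemma pull_mul a b : B *m pull A B mu a b = s *: mu (B *m a) (B *m b).
Proof. by rewrite pullE /pull_fun mulmxA BA mul_scalar_mx. Qed.

(** The image under [B] is what the induction propagates. Since [B] may be singular, this image does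
    not control [a]; the last clause does, a genuine product being a multiple of some [A *m k]. *)
Lemma product_of_pull t a : product_of (pull A B mu) t a ->
  exists k, [/\ product_of mu t k, exists r, B *m a = r *: k &
   (1 < t)%N -> exists r, a = r *: (A *m k)].
Proof.
elim=> {t a} [a|t t' a b _ [k [pk [r ak] _]] _ [l [pl [r' bl] _]]].
  by exists (B *m a); split=> //; [exact: product1 | exists 1; rewrite scale1r].
exists (mu k l); split; first exact: productM.
  exists (s * (r * r')).
  by rewrite pull_mul ak bl !linearZ /= scale_lfunE !scalerA; congr (_ *: _); ring.
move=> _; exists (r * r').
rewrite pullE /pull_fun ak bl !linearZ /= scale_lfunE -!scalemxAr scalerA.
by rewrite mulrC.
Qed.

Lemma pull_nilpotent : nilpotent mu -> nilpotent (pull A B mu).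
Proof.
move=> [t t0 nt]; exists t => // a.
have [t1|t1] := ltnP 1 t.
  by move=> /product_of_pull[k [/nt -> _ /(_ t1)[r ->]]]; rewrite mulmx0 scaler0.
(* Every vector is a product of one element, so here the hypothesis on [mu] already says that the
   whole space is zero. *)
have t_1 : t = 1 by apply/eqP; rewrite eqn_leq t1 t0.
by move=> _; apply: nt; rewrite t_1; exact: product1.
Qed.

Lemma pull_jordan : jordan mu -> jordan (pull A B mu).
Proof.
move=> jmu a; apply/lfunP => b; rewrite !comp_lfunE.
have /lfunP/(_ (B *m b)) := jmu (B *m a); rewrite !comp_lfunE => jb.
rewrite [LHS]pullE [RHS]pullE /pull_fun !pull_mul !linearZ /= !scale_lfunE.
by rewrite !linearZ /= jb.
Qed.

Lemma pull_nilpotent_jordan : nilpotent_jordan mu -> nilpotent_jordan (pull A B mu).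
Proof. by move=> [jm nm]; split; [apply: pull_jordan | apply: pull_nilpotent]. Qed.

End Pull.

(** In a bracketing of more than two elements, one of the two outermost factors is itself a
    product. *)
Lemma product_of_two_step mu t a : (forall x y z, mu (mu x y) z = 0) ->
  product_of mu t a -> (2 < t)%N -> a = 0.
Proof.
move=> m3; case=> // s1 s2 x y px py.
case: px => [x'|? ? ? ? _ _]; last by rewrite m3.
by case: py => // ? ? ? ? _ _ _; rewrite symbilinC m3.
Qed.

Lemma square_nilpotent_jordan phi u : ev phi u = 0 ->
  nilpotent_jordan (square phi u).
Proof.
move=> phiu.
have m3 a b c : square phi u (square phi u a b) c = 0.
  by rewrite 2!squareE evZ phiu mulr0 mul0r scale0r.
split=> [a|].
  apply/lfunP => b; rewrite !comp_lfunE m3.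
  by rewrite [RHS]m3 linear0.
by exists 3 => // a p; exact: product_of_two_step p _.
Qed.

End SymmetricTensors.

(** * The products phi ^ 2 (x) u: their orbit, and how they arise as limits *)

Section RankOne.
Variables (R : realType) (n : nat).
Local Notation C := R[i].
Local Notation Cn := 'cV[C]_n.
Implicit Types (mu nu : symbilin R n) (a b u w x : Cn) (phi psi : 'rV[C]_n).

(** A group is not the union of two proper subgroups, here the kernels of [f] and [g]: one of x, y,
    x + y lies outside both. *)
Lemma avoid2 (V : zmodType) (f g : V -> C) (x y : V) :
  {morph f : a b / a + b} -> {morph g : a b / a + b} ->
  f x != 0 -> g y != 0 -> exists z, f z != 0 /\ g z != 0.
Proof.
move=> fD gD fx gy; have [gx|gx] := eqVneq (g x) 0; last by exists x.
have [fy|fy] := eqVneq (f y) 0; last by exists y.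
by exists (x + y); rewrite fD gD gx fy add0r addr0.
Qed.

Lemma ev0 phi : ev phi 0 = 0.
Proof. by rewrite /ev mulmx0 mxE. Qed.

Lemma evDl phi psi a : ev (phi + psi) a = ev phi a + ev psi a.
Proof. by rewrite /ev mulmxDl mxE. Qed.

Lemma evZl k phi a : ev (k *: phi) a = k * ev phi a.
Proof. by rewrite /ev -scalemxAl mxE. Qed.

Lemma evB phi a b : ev phi (a - b) = ev phi a - ev phi b.
Proof. by rewrite evD -scaleN1r evZ mulN1r. Qed.

Lemma evBl phi psi a : ev (phi - psi) a = ev phi a - ev psi a.
Proof. by rewrite evDl -scaleN1r evZl mulN1r. Qed.

Lemma ev_covector u : u != 0 -> exists phi, ev phi u != 0.
Proof. by move=> /cV0Pn[i ui]; exists (delta_mx 0 i); rewrite ev_delta. Qed.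

Lemma ev_vector phi : phi != 0 -> exists a, ev phi a != 0.
Proof.
by move=> /rV0Pn[i ui]; exists (delta_mx i 0); rewrite /ev -colE mxE.
Qed.

Lemma covector_avoid2 u w : u != 0 -> w != 0 ->
  exists phi, ev phi u != 0 /\ ev phi w != 0.
Proof.
move=> /ev_covector[phi phiu] /ev_covector[psi psiw].
by apply: (@avoid2 'rV[C]_n (fun p => ev p u) (fun p => ev p w) phi psi _ _ phiu psiw);
  move=> x y; rewrite evDl.
Qed.

Lemma vector_avoid2 phi psi : phi != 0 -> psi != 0 ->
  exists u, ev phi u != 0 /\ ev psi u != 0.
Proof.
move=> /ev_vector[a pa] /ev_vector[b pb].
by apply: (@avoid2 Cn (ev phi) (ev psi) a b _ _ pa pb) => x y; rewrite evD.
Qed.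

Lemma mulmx_ev phi a : phi *m a = (ev phi a)%:M.
Proof. by rewrite [LHS]mx11_scalar. Qed.

Lemma rank1_act x psi a : (x *m psi) *m a = ev psi a *: x.
Proof. by rewrite -mulmxA mulmx_ev mul_mx_scalar. Qed.

Lemma rank1_coact x psi phi : phi *m (x *m psi) = ev phi x *: psi.
Proof. by rewrite mulmxA mulmx_ev mul_scalar_mx. Qed.

Lemma rank1_update_act x psi a : (1%:M + x *m psi) *m a = a + ev psi a *: x.
Proof. by rewrite mulmxDl mul1mx rank1_act. Qed.

(** The inverse is given by the Sherman-Morrison formula. *)
Lemma rank1_unit x psi : 1 + ev psi x != 0 -> 1%:M + x *m psi \in unitmx.
Proof.
move=> d0; suff /mulmx1_unit[] : (1%:M + x *m psi) *m
    (1%:M - (1 + ev psi x)^-1 *: (x *m psi)) = 1%:M by [].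
rewrite mulmxBr mulmx1 -scalemxAr mulmxDl mul1mx mulmxA rank1_act.
rewrite -scalemxAl -{2}[x *m psi]scale1r -scalerDl scalerA mulVf // scale1r.
by rewrite addrK.
Qed.

Lemma square_transitive phi u phi' u' :
  phi != 0 -> u != 0 -> ev phi u = 0 ->
  phi' != 0 -> u' != 0 -> ev phi' u' = 0 ->
  exists2 g, g \in unitmx & phi' *m g = phi /\ g *m u = u'.
Proof.
move=> phi0 u0 phiu phi'0 u'0 phi'u'.
(* First the covectors are matched by a rank-one update of the identity along a vector [x] on which
   neither vanishes. *)
have [g gU gphi] : exists2 g, g \in unitmx & phi' *m g = phi.
  have [x [phix phi'x]] := vector_avoid2 phi0 phi'0.
  exists (1%:M + ((ev phi' x)^-1 *: x) *m (phi - phi')).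
    apply: rank1_unit; rewrite evZ evBl mulrBr mulVf // addrC subrK.
    by rewrite mulf_neq0 // invr_eq0.
  by rewrite mulmxDr mulmx1 rank1_coact evZ mulVf // scale1r addrC subrK.
(* It remains to move [u] to [v] inside the stabilizer of [phi]: an update in the direction v - u,
   which [phi] kills, does so. *)
pose v := invmx g *m u'.
have v0 : v != 0.
  by apply: contra u'0 => /eqP v0; rewrite -(mulKVmx gU u') -/v v0 mulmx0.
have phiv : ev phi v = 0 by rewrite /ev -gphi -mulmxA mulKVmx.
have [psi [psiu psiv]] := covector_avoid2 u0 v0.
exists (g *m (1%:M + (v - u) *m ((ev psi u)^-1 *: psi))).
  rewrite unitmx_mul gU rank1_unit // evZl evB mulrBr mulVf // addrC subrK.
  by rewrite mulf_neq0 // invr_eq0.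
split.
  rewrite mulmxA gphi mulmxDr mulmx1 rank1_coact evB phiu phiv subrr.
  by rewrite scale0r addr0.
by rewrite -mulmxA rank1_update_act evZl mulVf // scale1r addrC subrK mulKVmx.
Qed.

Lemma square_eq0 phi u : (square phi u == 0) = (phi == 0) || (u == 0).
Proof.
apply/idP/idP => [/eqP sq0|/orP[]/eqP ->].
- have [//|/ev_vector[a pa]/=] := eqVneq phi 0.
  have /eqP := squareE phi u a a; rewrite sq0 symbilin0 eq_sym scaler_eq0.
  by rewrite mulf_eq0 (negbTE pa).
- apply/eqP/symbilin_ext => a b.
  by rewrite squareE symbilin0 /ev !mul0mx mxE mul0r scale0r.
- by apply/eqP/symbilin_ext => a b; rewrite squareE symbilin0 scaler0.
Qed.

(** An invertible [g] replaces [phi] by phi g^-1 and [u] by g u, preserving phi(u) = 0; conversely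
    [square_transitive] connects any two such pairs. *)
Lemma gl_orbit_square phi u : phi != 0 -> u != 0 -> ev phi u = 0 ->
  gl_orbit (square phi u) =
  [set mu | exists phi' u', [/\ phi' != 0, u' != 0, ev phi' u' = 0 &
                                 square_tensor phi' u' mu]].
Proof.
move=> phi0 u0 phiu; apply/seteqP; split=> mu /=.
  move=> [g gU gmu]; exists (phi *m invmx g), (g *m u); split.
  - by apply: contra phi0 => /eqP h; rewrite -(mulmxKV gU phi) h mul0mx.
  - by apply: contra u0 => /eqP h; rewrite -(mulKmx gU u) h mulmx0.
  - by rewrite /ev mulmxA mulmxKV.
  - by move=> a b; rewrite gmu /gl_act squareE -scalemxAr /ev !mulmxA.
move=> [phi' [u' [phi'0 u'0 phi'u' sq]]].
have [g gU [gphi gu]] := square_transitive phi0 u0 phiu phi'0 u'0 phi'u'.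
exists g => // a b; rewrite /gl_act squareE -scalemxAr gu sq -gphi.
by rewrite /ev -!mulmxA !mulKVmx.
Qed.

Lemma symbilinDl mu a b w : mu (a + b) w = mu a w + mu b w.
Proof. by rewrite linearD add_lfunE. Qed.

Lemma symbilinZl mu k a w : mu (k *: a) w = k *: mu a w.
Proof. by rewrite linearZ scale_lfunE. Qed.

Lemma symbilinDr mu a b w : mu w (a + b) = mu w a + mu w b.
Proof. exact: linearD. Qed.

Lemma symbilinZr mu k a w : mu w (k *: a) = k *: mu w a.
Proof. exact: linearZ. Qed.

Lemma exists_square_neq0 mu : mu != 0 -> exists w, mu w w != 0.
Proof.
move=> mu0; apply: contrapT => no; move/eqP: mu0; apply.
have sq0 w : mu w w = 0 by apply/eqP; apply: contrapT => /negP h; apply: no; exists w.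
apply: symbilin_ext => a b; rewrite symbilin0.
have := sq0 (a + b); rewrite !linearD /= !add_lfunE !sq0 add0r addr0.
rewrite (symbilinC mu b) => /eqP.
by rewrite -mulr2n -scaler_nat scaler_eq0 pnatr_eq0 => /eqP.
Qed.

(** If phi(w) = 0, then [w] is perturbed to w + t f with phi(f) nonzero; the square of this vector
    is a quadratic polynomial in t with nonzero constant term. *)
Lemma exists_square_ev_neq0 mu phi : mu != 0 -> phi != 0 ->
  exists w, mu w w != 0 /\ ev phi w = 1.
Proof.
move=> mu0 phi0; suff [w [w0 phiw]] : exists w, mu w w != 0 /\ ev phi w != 0.
  exists ((ev phi w)^-1 *: w); rewrite evZ mulVf //; split=> //.
  by rewrite !linearZ /= scale_lfunE linearZ /= !scaler_eq0 invr_eq0 (negbTE phiw).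
have [w w0] := exists_square_neq0 mu0.
have [phiw|] := eqVneq (ev phi w) 0; last by exists w.
have [f phif] := ev_vector phi0.
have expand (t : C) : mu (w + t *: f) (w + t *: f) =
    mu w w + t *: (mu w f *+ 2) + t ^+ 2 *: mu f f.
  rewrite symbilinDl symbilinZl !symbilinDr !symbilinZr (symbilinC mu f w).
  by rewrite mulr2n !scalerDr !addrA !scalerA expr2.
have phit (t : C) : t != 0 -> ev phi (w + t *: f) != 0.
  by move=> t0; rewrite evD evZ phiw add0r mulf_neq0.
apply: contrapT => no.
have sq0 (t : C) : t != 0 -> mu w w + t *: (mu w f *+ 2) + t ^+ 2 *: mu f f = 0.
  move=> t0; apply/eqP; apply: contrapT => /negP h; apply: no.
  by exists (w + t *: f); rewrite expand; split=> //; exact: phit.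
have /cV0Pn[i /eqP] := w0; apply.
have entry (t : C) : t != 0 ->
    mu w w i 0 + t * (mu w f i 0 *+ 2) + t ^+ 2 * mu f f i 0 = 0.
  by move=> /sq0/(congr1 (fun v : Cn => v i 0)); rewrite !mxE !mulr2n.
have h1 := entry 1 (oner_neq0 _).
have h2 : _ = 0 := entry (-1) _; rewrite oppr_eq0 oner_eq0 in h2.
have h3 : _ = 0 := entry 2 _; rewrite pnatr_eq0 in h3.
(* Interpolation: q(0) = q(1) + (q(-1) - q(2)) / 3 for every quadratic polynomial q. *)
transitivity (mu w w i 0 + 1 * (mu w f i 0 *+ 2) + 1 ^+ 2 * mu f f i 0
  + 3^-1 * (mu w w i 0 + (-1) * (mu w f i 0 *+ 2) + (-1) ^+ 2 * mu f f i 0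
    - (mu w w i 0 + 2 * (mu w f i 0 *+ 2) + 2 ^+ 2 * mu f f i 0))).
  by field.
by rewrite h1 h2 // h3 // subrr mulr0 addr0.
Qed.

(** Multiplying repeatedly by [w] exhibits l^k w as a product of k + 1 elements, which is zero for k
    + 1 = t; if [l] is nonzero, then so is [w]. *)
Lemma nilpotent_square_not_line mu w l : nilpotent mu ->
  mu w w = l *: w -> mu w w = 0.
Proof.
move=> [t t0 nt] ww; have [l_0|l0] := eqVneq l 0; first by rewrite ww l_0 scale0r.
suff pw k : product_of mu k.+1 (l ^+ k *: w).
  have := pw t.-1; rewrite (prednK t0) => /nt/eqP.
  by rewrite scaler_eq0 expf_eq0 (negbTE l0) andbF => /eqP ->; rewrite linear0.
elim: k => [|k IHk]; first exact: product1.
have -> : l ^+ k.+1 *: w = mu w (l ^+ k *: w).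
  by rewrite linearZ /= ww scalerA exprSr.
by rewrite -[k.+2]add1n; apply: productM => //; exact: product1.
Qed.

(* The degenerations [P = u psi] and [Q = 1 - w phi] are the limits at [s = 0]
   of the families of [pull_proj] below; applied in turn they leave of [mu]
   only the component psi (mu w w). *)
Lemma square_limit mu phi u : mu != 0 -> nilpotent mu ->
  phi != 0 -> u != 0 -> ev phi u = 0 ->
  exists P Q k, [/\ P *m P = P, Q *m Q = Q, k != 0 &
    pull Q (1%:M - Q) (pull P (1%:M - P) mu) = k *: square phi u].
Proof.
move=> mu0 nilmu phi0 u0 phiu.
have [w [ww0 phiw]] := exists_square_ev_neq0 mu0 phi0.
(* The component of w^2 in the kernel of [phi], along [w]. It vanishes only if w^2 lies on the line
   of [w], which nilpotency excludes. *)
pose y := mu w w - ev phi (mu w w) *: w.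
have y0 : y != 0.
  apply: contra ww0; rewrite subr_eq0 => /eqP.
  by move=> /(nilpotent_square_not_line nilmu) ->.
have [chi [chiu chiy]] := covector_avoid2 u0 y0.
(* Correcting [chi] by [phi] forces psi(w) = 0, scaling gives psi(u) = 1, and psi(w^2) is chi(y) /
   chi(u), hence nonzero. *)
pose psi := (ev chi u)^-1 *: (chi - ev chi w *: phi).
have psiE x : ev psi x = (ev chi u)^-1 * ev chi (x - ev phi x *: w).
  by rewrite /psi evZl evBl evZl evB evZ [ev phi x * _]mulrC.
have psiu : ev psi u = 1 by rewrite psiE phiu scale0r subr0 mulVf.
have psiw : ev psi w = 0 by rewrite psiE phiw scale1r subrr ev0 mulr0.
have psiww : ev psi (mu w w) != 0.
  by rewrite psiE mulf_neq0 // invr_eq0.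
exists (u *m psi), (1%:M - w *m phi), (ev psi (mu w w)); split => //.
- by rewrite mulmxA rank1_act psiu scale1r.
- rewrite mulmxBr mulmx1 mulmxBl mul1mx [_ *m (w *m phi)]mulmxA rank1_act.
  by rewrite phiw scale1r subrr subr0.
apply: symbilin_ext => a b; rewrite pull_pull pullE /pull_fun.
have -> : (1%:M - u *m psi) *m (1%:M - (1%:M - w *m phi)) = w *m phi.
  by rewrite subKr mulmxBl mul1mx mulmxA rank1_act psiw scale0r mul0mx subr0.
have -> : (1%:M - w *m phi) *m (u *m psi) = u *m psi.
  by rewrite mulmxA mulmxBl mul1mx rank1_act phiu scale0r subr0.
rewrite !rank1_act symbilinZl symbilinZr !evZ symbilinZ squareE.
by rewrite scalerA; congr (_ *: _); ring.
Qed.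

End RankOne.

(** * Irreducible components *)

Section PolynomialCurves.
Variables (K : numFieldType) (V : lmodType K).

Definition poly_curve (c : K -> V) : Prop :=
  exists d (T : 'I_d -> V), forall t, c t = \sum_(k < d) t ^+ k *: T k.

Lemma poly_fun_curve (f : V -> K) c : poly_fun f -> poly_curve c ->
  exists p : {poly K}, forall t, f (c t) = p.[t].
Proof.
move=> pf [d [T cE]]; elim: pf => {f} [k|f|f g _ [p fp] _ [q gq]|f g _ [p fp] _ [q gq]].
- by exists k%:P => t; rewrite hornerC.
- exists (\sum_(k < d) f (T k) *: 'X^k) => t.
  rewrite cE linear_sum horner_sum; apply: eq_bigr => k _.
  by rewrite linearZ hornerZ hornerXn mulrC.
- by exists (p + q) => t; rewrite hornerD fp gq.
- by exists (p * q) => t; rewrite hornerM fp gq.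
Qed.

Lemma poly_fun_linear (f : V -> K) (L : {linear V -> V}) :
  poly_fun f -> poly_fun (f \o L).
Proof.
elim=> {f} [k|f|f g _ pf _ pg|f g _ pf _ pg].
- exact: poly_cst.
- exact: (poly_lin (f \o L)).
- exact: (poly_add pf pg).
- exact: (poly_mul pf pg).
Qed.

(** In characteristic zero the integers below [size p] are distinct, and there are more of them than
    [p] has roots. *)
Lemma exists_nonroot (p : {poly K}) : p != 0 -> exists t, p.[t] != 0.
Proof.
move=> p0; apply: contrapT => no.
pose rs : seq K := [seq i%:R | i <- iota 0 (size p)].
have /(max_poly_roots p0) : all (root p) rs.
  apply/allP => x _; apply: contrapT => /negP px; apply: no.
  by exists x; rewrite -rootE.
rewrite map_inj_uniq ?iota_uniq; last by move=> i j /eqP; rewrite eqr_nat => /eqP.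
by rewrite size_map size_iota ltnn => /(_ isT).
Qed.

(** Irreducibility of the affine line, on which both the components and the Zariski connectedness
    rest. *)
Lemma exists_common_nonroot (p q : {poly K}) s t : p.[s] != 0 -> q.[t] != 0 ->
  exists r, p.[r] != 0 /\ q.[r] != 0.
Proof.
move=> ps qt; have [r] : exists r, (p * q).[r] != 0.
  apply: exists_nonroot; rewrite mulf_neq0 //.
    by apply: contraNneq ps => ->; rewrite horner0.
  by apply: contraNneq qt => ->; rewrite horner0.
by rewrite hornerM mulf_eq0 negb_or => /andP[]; exists r.
Qed.

Lemma not_zero_locus (X : Type) (S : set (X -> K)) x :
  ~ zero_locus S x -> exists2 f, S f & f x != 0.
Proof.
move=> nz; apply: contrapT => no; apply: nz => f Sf.
by apply/eqP; apply: contrapT => /negP fx; apply: no; exists f.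
Qed.

Lemma zariski_closedP (A : set (zariski V)) :
  closed A <-> exists2 S, S `<=` @poly_fun K V & A = zero_locus S.
Proof.
split=> [/closed_openC [S SF AS]|[S SF ->]].
  by exists S => //; rewrite -AS setCK.
by rewrite -[zero_locus S]setCK; apply: open_closedC; exists S; rewrite ?setCK.
Qed.

Lemma zariski_closed_preimage (L : {linear V -> V}) (A : set (zariski V)) :
  closed A -> closed (L @^-1` A : set (zariski V)).
Proof.
move=> /zariski_closedP[S SF ->]; apply/zariski_closedP.
exists [set f \o L | f in S].
  by move=> _ [f /SF pf <-]; exact: poly_fun_linear.
apply/seteqP; split=> [x zx _ [f Sf <-]|x zx f Sf]; first exact: zx.
by apply: (zx (f \o L)); exists f.
Qed.

(** Each F_t maps [Z] into [A] or into [B], by irreducibility of [Z]. If the union of the images lay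
    in neither, a curve t -> F_t v would leave [A] at every nonroot of a nonzero polynomial, and
    likewise for [B]; a common nonroot is a contradiction. *)
Lemma irreducible_family (F : K -> {linear V -> V}) (Z : set (zariski V)) :
  (forall v, poly_curve (fun t => F t v)) -> irreducible Z ->
  irreducible ([set w | exists t v, Z v /\ w = F t v] : set (zariski V)).
Proof.
move=> Fc [[z Zz] irrZ]; split; first by exists (F 0 z), 0, z.
move=> A B cA cB YAB.
have AorB t : Z `<=` F t @^-1` A \/ Z `<=` F t @^-1` B.
  apply: irrZ; [exact: zariski_closed_preimage..|].
  by move=> v Zv; apply: YAB; exists t, v.
apply: contrapT => /not_orP[nA nB].
have escape (D : set (zariski V)) : closed D ->
    ~ [set w | exists t v, Z v /\ w = F t v] `<=` D ->
    exists (p : {poly K}) s, p.[s] != 0 /\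
      forall t, p.[t] != 0 -> ~ Z `<=` F t @^-1` D.
  move=> /zariski_closedP[S SF ->] nD.
  have [t [v [Zv nv]]] : exists t v, Z v /\ ~ zero_locus S (F t v).
    by apply: contrapT => no; apply: nD => _ [t [v [Zv ->]]]; apply: contrapT => h;
      apply: no; exists t, v.
  have [f Sf fv] := not_zero_locus nv.
  have [p fp] := poly_fun_curve (SF _ Sf) (Fc v).
  exists p, t; split; first by rewrite -fp.
  by move=> s; rewrite -fp => fs /(_ _ Zv)/(_ _ Sf)/eqP; apply/negP.
have [p [s [ps pA]]] := escape A cA nA; have [q [t [qt qB]]] := escape B cB nB.
have [r [pr qr]] := exists_common_nonroot ps qt.
by case: (AorB r) => [/(pA _ pr)|/(qB _ qr)].
Qed.

(** The union of the F_t(Z) is irreducible, lies in [X] and contains [Z] through the parameter [t1],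
    so maximality makes it equal to [Z]. *)
Lemma component_stable (X Z : set (zariski V)) (F : K -> {linear V -> V}) t1 :
  irreducible_component X Z ->
  (forall v, poly_curve (fun t => F t v)) -> (forall t v, X v -> X (F t v)) ->
  (forall v, F t1 v = v) -> forall t v, Z v -> Z (F t v).
Proof.
move=> [ZX irrZ maxZ] Fc FX F1 t v Zv.
rewrite -(maxZ [set w | exists t v, Z v /\ w = F t v]).
- by exists t, v.
- by move=> _ [s [x [Zx ->]]]; apply/FX/ZX.
- exact: irreducible_family.
- by move=> x Zx; exists t1, x; rewrite F1.
Qed.

(** The point 0 alone is not maximal, since the line spanned by [v] is a larger irreducible subset
    of [X]. *)
Lemma component_neq0 (X Z : set (zariski V)) (v : V) :
  irreducible_component X Z -> v != 0 -> (forall t, X (t *: v)) ->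
  exists2 w : V, Z w & w != 0.
Proof.
move=> [ZX [[z Zz] irrZ] maxZ] v0 Xv; have [z0|] := eqVneq (z : V) 0; last by exists z.
apply: contrapT => no.
have Z0 : Z = [set (0 : V)].
  apply/seteqP; split=> [x Zx|_ ->]; last by rewrite -z0.
  by apply/eqP; apply: contrapT => /negP x0; apply: no; exists x.
have /seteqP[h _] : [set w | exists t (x : V), [set v] x /\ w = t *: x] = Z.
  apply: maxZ.
  - by move=> _ [t [_ [-> ->]]].
  - apply: (irreducible_family (F := fun t => (GRing.scale t : {linear V -> V}))).
      move=> x; exists 2, (fun k => if k == 1 :> nat then x else 0) => t.
      by rewrite !big_ord_recl big_ord0 /= scaler0 add0r addr0 expr1.
    by split=> [|A B _ _ AB]; [exists v|case: (AB v erefl) => ?; [left|right] => _ ->].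
  - by rewrite Z0 => _ ->; exists 0, v; rewrite scale0r.
have : Z v by apply: h; exists 1, v; rewrite scale1r.
by rewrite Z0 => /eqP; rewrite (negbTE v0).
Qed.

End PolynomialCurves.

(** * One-parameter families attached to a projection *)

Section ProjectionFamilies.
Variables (R : realType) (n : nat).
Local Notation C := R[i].
Local Notation Cn := 'cV[C]_n.
Implicit Types (mu nu : symbilin R n) (P : 'M[C]_n).

(** For a projection [P] and nonzero [s], [proj_snd] is [s] times the inverse of [proj_fst], so
    [pull_proj] is the action of [proj_fst] multiplied by s^2. This clears the denominators and
    extends the family to s = 0. *)
Definition proj_fst P (s : C) : 'M[C]_n := P + s *: (1%:M - P).
Definition proj_snd P (s : C) : 'M[C]_n := s *: P + (1%:M - P).

Definition pull_proj P (s : C) : {linear symbilin R n -> symbilin R n} :=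
  pull (proj_fst P s) (proj_snd P s).

Lemma proj_snd_fst P s : P *m P = P -> proj_snd P s *m proj_fst P s = s%:M.
Proof.
move=> PP; have P' : P *m (1%:M - P) = 0 by rewrite mulmxBr mulmx1 PP subrr.
have P'' : (1%:M - P) *m P = 0 by rewrite mulmxBl mul1mx PP subrr.
have P1 : (1%:M - P) *m (1%:M - P) = 1%:M - P.
  by rewrite mulmxBr mulmx1 P'' subr0.
rewrite /proj_snd /proj_fst mulmxDl !mulmxDr -!scalemxAl -!scalemxAr.
rewrite PP P' P'' P1 !scaler0 addr0 add0r -scalerDr addrC subrK.
by rewrite scalemx1.
Qed.

Lemma pull_proj1 P mu : pull_proj P 1 mu = mu.
Proof.
rewrite /pull_proj /= /proj_fst /proj_snd !scale1r.
have -> : P + (1%:M - P) = 1%:M by rewrite addrC subrK.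
exact: pull1.
Qed.

Lemma pull_proj0 P mu : pull_proj P 0 mu = pull P (1%:M - P) mu.
Proof. by rewrite /pull_proj /= /proj_fst /proj_snd !scale0r addr0 add0r. Qed.

Lemma pull_proj_nilpotent_jordan P s mu : P *m P = P ->
  nilpotent_jordan mu -> nilpotent_jordan (pull_proj P s mu).
Proof. by move=> PP; apply: pull_nilpotent_jordan; apply: proj_snd_fst. Qed.

Lemma pull_scalar (s : C) mu : pull s%:M s%:M mu = s ^+ 3 *: mu.
Proof.
apply: symbilin_ext => a b; rewrite pullE /pull_fun symbilinZ !mul_scalar_mx.
by rewrite symbilinZl symbilinZr !scalerA -!expr2 -exprS.
Qed.

(** Pulling back along the two matrices in exchanged roles undoes [pull_proj] up to the factor
    s^3. *)
Lemma pull_proj_neq0 P s mu : P *m P = P -> s != 0 -> mu != 0 ->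
  pull_proj P s mu != 0.
Proof.
move=> PP s0; apply: contra => /eqP h; have := pull_scalar s mu.
rewrite -(proj_snd_fst s PP) -pull_pull -/(pull_proj P s mu) h linear0.
by move=> /esym/eqP; rewrite scaler_eq0 expf_eq0 (negbTE s0) andbF.
Qed.

Lemma of_table_sum d (k : 'I_d -> C) (g : 'I_d -> 'I_n -> 'I_n -> Cn) :
  of_table (fun i j => \sum_(l < d) k l *: g l i j) =
  \sum_(l < d) k l *: of_table (g l).
Proof.
have sym2_sum phi psi i j : sym2 phi psi (\sum_(l < d) k l *: g l i j) =
    \sum_(l < d) k l *: sym2 phi psi (g l i j).
  apply: symbilin_ext => a b; rewrite symbilin_sum sym2E /sym2_fun scaler_sumr.
  apply: eq_bigr => l _; rewrite symbilinZ sym2E /sym2_fun !scalerA.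
  by rewrite [k l * _]mulrC.
rewrite /of_table; under eq_bigr do under eq_bigr do rewrite sym2_sum.
under [RHS]eq_bigr do rewrite scalerA mulrC -scalerA.
rewrite -scaler_sumr; congr (_ *: _).
under [RHS]eq_bigr do rewrite scaler_sumr.
rewrite [RHS]exchange_big; apply: eq_bigr => i _ /=.
by rewrite exchange_big; apply: eq_bigr => l _; rewrite scaler_sumr.
Qed.

Lemma poly_curve_pull_proj P mu : poly_curve (fun s => pull_proj P s mu).
Proof.
pose P' := 1%:M - P.
pose m (A B B' : 'M[C]_n) i j : Cn := A *m mu (B *m delta_mx i 0) (B' *m delta_mx j 0).
(* Coefficients of s^0 to s^3: the outer matrix brings a factor [s] with [P'], each inner one with
   [P]. *)
pose g := [:: fun i j => m P P' P' i j;
  fun i j => m P' P' P' i j + m P P P' i j + m P P' P i j;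
  fun i j => m P' P P' i j + m P' P' P i j + m P P P i j;
  fun i j => m P' P P i j].
exists 4, (fun l => of_table (nth (fun _ _ => 0) g l)) => s.
rewrite -of_table_sum /pull_proj /= /pull -lock; congr of_table.
apply/funext => i; apply/funext => j.
rewrite !big_ord_recl big_ord0 /= /pull_fun /proj_fst /proj_snd -/P' /m.
move: (delta_mx i 0) (delta_mx j 0) => a b; clear.
have -> : mu ((s *: P + P') *m a) ((s *: P + P') *m b) =
    (s ^+ 2 *: mu (P *m a) (P *m b) + s *: mu (P *m a) (P' *m b)) +
    (s *: mu (P' *m a) (P *m b) + mu (P' *m a) (P' *m b)).
  rewrite !mulmxDl -!scalemxAl symbilinDl symbilinZl !symbilinDr !symbilinZr.
  by rewrite scalerDr scalerA -expr2.
move: (mu _ _) (mu _ _) (mu _ _) (mu _ _) => v00 v01 v10 v11.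
rewrite [LHS]mulmxDl -scalemxAl !mulmxDr -!scalemxAr.
move: (P *m v00) (P *m v01) (P *m v10) (P *m v11) => u00 u01 u10 u11.
move: (P' *m v00) (P' *m v01) (P' *m v10) (P' *m v11) => w00 w01 w10 w11.
apply/colP => k; rewrite !mxE; ring.
Qed.

Lemma poly_curve_scale (V : lmodType C) (v : V) : poly_curve (fun s : C => s *: v).
Proof.
exists 2, (fun k => if k == 1 :> nat then v else 0) => t.
by rewrite !big_ord_recl big_ord0 /= scaler0 add0r addr0 expr1.
Qed.

End ProjectionFamilies.

(** * Connectedness *)

Section RelativeClopen.
Variable T : topologicalType.
Implicit Types A B : set T.

Definition rel_clopen A B : Prop :=
  (exists2 U, open U & B = A `&` U) /\ (exists2 F, closed F & B = A `&` F).

(** [connected] quantifies over nonempty relatively clopen subsets: such a [B] contains [p0] through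
    any of its points, and then all of [A]. *)
Lemma connected_from A p0 : A p0 ->
  (forall p B, A p -> rel_clopen A B -> B p <-> B p0) -> connected A.
Proof.
move=> Ap0 h B [p Bp] Bo Bc; have BA : B `<=` A by case: Bo => U _ ->; apply: subIsetl.
have clop : rel_clopen A B by split.
have /(h p B (BA _ Bp) clop) Bp0 := Bp.
by apply/seteqP; split=> // q Aq; apply/(h q B Aq clop).
Qed.

End RelativeClopen.

Section ProjectiveZariski.
Variables (K : numFieldType) (V : lmodType K).

Definition proj_class (v : V) (v0 : v != 0) : proj V :=
  \pi_(proj V)%qT (exist (fun v : V => v != 0) v v0).

Lemma proj_class_eq (v w : V) (v0 : v != 0) (w0 : w != 0) k : k != 0 ->
  v = k *: w -> proj_class v0 = proj_class w0.
Proof.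
by move=> k0 vw; apply/eqmodP/asboolP; exists k.
Qed.

Lemma proj_classP (A : set V) p : projectivization A p <->
  exists v (v0 : v != 0), A v /\ p = proj_class v0.
Proof.
split=> [[[v v0] Av <-]|[v [v0 [Av ->]]]]; first by exists v, v0.
by exists (exist _ v v0).
Qed.

(** The canonical representative is a nonzero multiple of [v], so homogeneity only introduces a
    nonzero factor. *)
Lemma proj_fun_neq0 f v (v0 : v != 0) : homog_poly_fun f ->
  (proj_fun f (proj_class v0) != 0) = (f v != 0).
Proof.
move=> [_ [d fd]]; rewrite /proj_fun.
have /eqmodP/asboolP[k k0 ->] : repr (proj_class v0) = exist _ v v0 %[mod proj V]%qT.
  exact: reprK.
by rewrite fd mulf_eq0 expf_eq0 (negbTE k0) andbF.
Qed.

(** If [B] contained the point at [s] but not the one at [t], a form nonzero at [s] and one nonzero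
    at [t] would restrict to nonzero polynomials on the curve; at a common nonroot the point would
    be both in [B] and outside it. *)
Lemma zariski_curve (A : set (proj_zariski V)) B (c : K -> V)
    (c0 : forall t, c t != 0) s t :
  poly_curve c -> (forall r, A (proj_class (c0 r))) -> rel_clopen A B ->
  B (proj_class (c0 s)) -> B (proj_class (c0 t)).
Proof.
move=> cp Ac [[U [S SF US] BU] [D /closed_openC[S' SF' DS'] BD]].
rewrite setCK in DS'; rewrite BU => -[_ Us].
rewrite -BU BD; split=> //; apply: contrapT => nD.
have [f Sf fs] : exists2 f, S f & f (proj_class (c0 s)) != 0.
  by apply: not_zero_locus; rewrite -US => /(_ Us).
have [g Sg gt] : exists2 g, S' g & g (proj_class (c0 t)) != 0.
  by apply: not_zero_locus; rewrite -DS'.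
have [f' hf ff'] := SF _ Sf; have [g' hg gg'] := SF' _ Sg.
have [p fp] := poly_fun_curve hf.1 cp; have [q gq] := poly_fun_curve hg.1 cp.
have [r []] : exists r, p.[r] != 0 /\ q.[r] != 0.
  apply: (exists_common_nonroot (s := s) (t := t)).
    by rewrite -fp -(proj_fun_neq0 (c0 s)) // ff'.
  by rewrite -gq -(proj_fun_neq0 (c0 t)) // gg'.
rewrite -fp -gq -(proj_fun_neq0 (c0 r)) // -(proj_fun_neq0 (c0 r) hg) ff' gg'.
move=> fr gr; have : B (proj_class (c0 r)).
  rewrite BU; split=> //; apply: contrapT => nU.
  have : zero_locus S (proj_class (c0 r)) by rewrite -US.
  by move=> /(_ _ Sf)/eqP; apply/negP.
by rewrite BD DS' => -[_ /(_ _ Sg)/eqP]; apply/negP.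
Qed.

End ProjectiveZariski.

(** * Polynomial curves in the classical topology *)

Section ProjectiveClassical.
Variables (R : realType) (n : nat).
Local Notation C := R[i].
Local Notation Cn := 'cV[C]_n.
Variable dot : {dot Cn for Num.conj}.
Local Notation V := (symbilin R n).
Implicit Types mu nu : V.

Lemma Re_mul_real (t : R) (z : C) : complex.Re (t%:C%C * z) = t * complex.Re z.
Proof. by case: z => a b /=; rewrite mul0r subr0. Qed.

Lemma Im_mul_real (t : R) (z : C) : complex.Im (t%:C%C * z) = t * complex.Im z.
Proof. by case: z => a b /=; rewrite mul0r addr0. Qed.

(** Along a real parameter, the real and imaginary parts of the structure constants are real
    polynomials; continuity of the curve thus reduces to that of a polynomial. *)
Lemma curve_sqnorm_poly (c : C -> V) (t0 : R) : poly_curve c ->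
  exists q : {poly R}, forall t : R,
    complex.Re (sqnorm dot (c t%:C%C - c t0%:C%C)) = q.[t].
Proof.
move=> [d [T cE]].
pose p (h : C -> R) i j k : {poly R} :=
  \sum_(l < d) h (sconst dot (T l) i j k) *: ('X^l - (t0 ^+ l)%:P).
have coef (t : R) i j k : sconst dot (c t%:C%C - c t0%:C%C) i j k =
    \sum_(l < d) (t ^+ l - t0 ^+ l)%:C%C * sconst dot (T l) i j k.
  rewrite !cE -sumrB /sconst symbilin_sum linear_sumlz; apply: eq_bigr => l _.
  by rewrite -scalerBl symbilinZ linearZl_LR /= rmorphB !rmorphXn.
have ReE (t : R) i j k :
    complex.Re (sconst dot (c t%:C%C - c t0%:C%C) i j k) = (p (@complex.Re R) i j k).[t].
  rewrite coef raddf_sum /p horner_sum; apply: eq_bigr => l _.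
  by rewrite [LHS]Re_mul_real hornerZ !hornerE mulrC.
have ImE (t : R) i j k :
    complex.Im (sconst dot (c t%:C%C - c t0%:C%C) i j k) = (p (@complex.Im R) i j k).[t].
  rewrite coef raddf_sum /p horner_sum; apply: eq_bigr => l _.
  by rewrite [LHS]Im_mul_real hornerZ !hornerE mulrC.
exists (\sum_i \sum_j \sum_k
  (p (@complex.Re R) i j k ^+ 2 + p (@complex.Im R) i j k ^+ 2)) => t.
rewrite sqnormE raddf_sum horner_sum; apply: eq_bigr => i _.
rewrite raddf_sum horner_sum; apply: eq_bigr => j _.
rewrite raddf_sum horner_sum; apply: eq_bigr => k _.
rewrite hornerD !horner_exp -ReE -ImE normCK.
by case: (sconst _ _ _ _ _) => a b /=; rewrite mulrN opprK !expr2.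
Qed.

Lemma norm_curve_near (c : C -> V) (t0 e : R) : poly_curve c -> 0 < e ->
  \forall t \near t0, norm dot (c t%:C%C - c t0%:C%C) < e.
Proof.
move=> /(@curve_sqnorm_poly _ t0)[q qE] e0.
have q0 : q.[t0] < e ^+ 2.
  have -> : q.[t0] = 0; last by rewrite exprn_gt0.
  rewrite -qE subrr sqnormE big1 // => i _; rewrite big1 // => j _.
  by rewrite big1 // => k _; rewrite /sconst symbilin0 linear0l normr0 expr0n.
have : q.[t] @[t --> t0] --> q.[t0] by exact: continuous_horner.
move=> /cvgr_lt/(_ _ q0); apply: filterS => t qt.
by rewrite /norm qE -[e](gtr0_norm e0) -sqrtr_sqr ltr_sqrt ?exprn_gt0.
Qed.

(** The preimage of [B] under the curve restricted to real parameters is clopen in the connected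
    real line. *)
Lemma classical_curve (A B : set (proj_classical dot)) (c : C -> V)
    (c0 : forall t, c t != 0) (s t : R) :
  poly_curve c -> (forall r, A (proj_class (c0 r))) -> rel_clopen A B ->
  B (proj_class (c0 s%:C%C)) -> B (proj_class (c0 t%:C%C)).
Proof.
move=> cp Ac [[U Uo BU] [D /closed_openC Do BD]] Bs.
pose g (r : R) : proj_classical dot := proj_class (c0 r%:C%C).
have go (W : set (proj_classical dot)) : open W -> open (g @^-1` W).
  move=> Wo; rewrite openE => r Wr.
  (* Openness in the quotient topology unfolds to openness in norm of the set of representatives. *)
  have [e e0 eW] : exists2 e : R, 0 < e & forall v : nonzero V,
      norm dot (val v - c r%:C%C) < e -> W (\pi_(proj V)%qT v).
    exact: (Wo (exist _ (c r%:C%C) (c0 r%:C%C)) Wr).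
  have := norm_curve_near r cp e0; apply: filterS => r' /=.
  exact: (eW (exist _ (c r'%:C%C) (c0 r'%:C%C))).
have conn : connected (setT : set R) by apply/connected_intervalP.
have BT : g @^-1` B = setT.
  apply: conn; first by exists s.
    exists (g @^-1` U); first exact: go.
    rewrite setTI BU; apply/seteqP; split=> r /= => [[]|Wr] //.
    by split; first exact: (Ac r%:C%C).
  exists (g @^-1` D).
    by rewrite -[D]setCK preimage_setC; exact: (open_closedC (go _ Do)).
  rewrite setTI BD; apply/seteqP; split=> r /= => [[]|Wr] //.
  by split; first exact: (Ac r%:C%C).
have : (g @^-1` B) t by rewrite BT.
by [].
Qed.

End ProjectiveClassical.

(** * Conclusions for nilpotent Jordan algebras *)

Section Main.
Variables (R : realType) (n : nat).
Local Notation C := R[i].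
Local Notation V := (symbilin R n).

(** A component is stable under the degenerations at s = 0 and under scaling, and it contains a
    nonzero algebra; [square_limit] leads from there to phi ^ 2 (x) u. *)
Lemma component_square (Z : set (zariski V)) (phi : 'rV[C]_n) u :
  phi != 0 -> u != 0 -> ev phi u = 0 ->
  @irreducible_component (zariski V) (@nilpotent_jordan R n) Z -> Z (square phi u).
Proof.
move=> phi0 u0 phiu cZ.
have stable_proj P mu : P *m P = P -> Z mu -> Z (pull P (1%:M - P) mu).
  move=> PP Zmu; rewrite -pull_proj0.
  apply: (component_stable (t1 := 1) cZ (poly_curve_pull_proj P)) => // [s v|v].
    exact: pull_proj_nilpotent_jordan.
  exact: pull_proj1.
have scaleN (s : C) (mu : V) : nilpotent_jordan mu -> nilpotent_jordan (s *: mu).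
  have -> : s *: mu = pull s%:M 1%:M mu.
    apply: symbilin_ext => a b.
    by rewrite symbilinZ pullE /pull_fun !mul1mx mul_scalar_mx.
  by apply: pull_nilpotent_jordan; rewrite mul1mx.
have stable_scale (s : C) mu : Z mu -> Z (s *: mu).
  apply: (component_stable (F := fun t => (GRing.scale t : {linear V -> V}))
    (t1 := 1) cZ (poly_curve_scale (V := V))) => // v; exact: scale1r.
have [mu Zmu mu0] : exists2 mu : V, Z mu & mu != 0.
  apply: (component_neq0 (v := square phi u) cZ).
    by rewrite square_eq0 (negbTE phi0).
  by move=> t; apply/scaleN/square_nilpotent_jordan.
have Nmu : nilpotent_jordan mu by case: cZ => ZN _ _; exact: ZN.
have [P [Q [k [PP QQ k0 lim]]]] := square_limit mu0 Nmu.2 phi0 u0 phiu.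
rewrite -[square phi u]scale1r -(mulVf k0) -scalerA -lim.
by apply/stable_scale/stable_proj => //; exact: stable_proj.
Qed.

(* [H] abstracts the fact that, in either topology on the projective space, a
   relatively clopen set does not separate two points of a real segment of a
   polynomial curve. *)
Lemma nilpotent_jordan_connected (B : set (proj V)) (phi : 'rV[C]_n) u
    (sq0 : square phi u != 0) (mu : V) (mu0 : mu != 0) :
  (forall (c : C -> V) (c0 : forall t, c t != 0), poly_curve c ->
     (forall r, nilpotent_jordan (c r)) ->
     B (proj_class (c0 0)) <-> B (proj_class (c0 1))) ->
  ev phi u = 0 -> nilpotent_jordan mu ->
  B (proj_class mu0) <-> B (proj_class sq0).
Proof.
move=> H phiu Nmu; have := sq0; rewrite square_eq0 => /norP[phi0 u0].
have [P [Q [k [PP QQ k0 lim]]]] := square_limit mu0 Nmu.2 phi0 u0 phiu.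
have step (S : 'M[C]_n) (nu : V) (nu0 : nu != 0) (lim0 : pull S (1%:M - S) nu != 0) :
    S *m S = S -> nilpotent_jordan nu ->
    B (proj_class nu0) <-> B (proj_class lim0).
  move=> SS Nnu; have c0 s : pull_proj S s nu != 0.
    have [->|s0] := eqVneq s 0; first by rewrite pull_proj0.
    exact: pull_proj_neq0.
  have -> : proj_class nu0 = proj_class (c0 1).
    by apply: (proj_class_eq _ _ (oner_neq0 C)); rewrite pull_proj1 scale1r.
  have -> : proj_class lim0 = proj_class (c0 0).
    by apply: (proj_class_eq _ _ (oner_neq0 C)); rewrite pull_proj0 scale1r.
  apply: iff_sym; apply: (H (fun s => pull_proj S s nu)).
    exact: poly_curve_pull_proj.
  by move=> r; exact: pull_proj_nilpotent_jordan.
have lim20 : pull Q (1%:M - Q) (pull P (1%:M - P) mu) != 0.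
  by rewrite lim scaler_eq0 negb_or k0.
have lim10 : pull P (1%:M - P) mu != 0.
  by apply: contraNneq lim20 => ->; rewrite linear0.
rewrite (step P _ _ lim10) //.
have N1 : nilpotent_jordan (pull P (1%:M - P) mu).
  by rewrite -pull_proj0; exact: pull_proj_nilpotent_jordan.
rewrite (step Q _ _ lim20) //.
by rewrite (proj_class_eq lim20 sq0 k0 lim).
Qed.

End Main.

Theorem theorem1p5 (R : realType) (n : nat) (n_ge2 : (2 <= n)%N)
    (dot : {dot 'cV[R[i]]_n for Num.conj}) :
  (exists mu0 : symbilin R n,
    [/\ mu0 != 0,
        nilpotent_jordan mu0,
        (forall Z : set (zariski (symbilin R n)),
           @irreducible_component (zariski (symbilin R n))
             (@nilpotent_jordan R n) Z -> Z mu0) &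
        [set mu | mu != 0 /\
           forall nu, nu != 0 -> energy dot nu <= energy dot mu] =
        gl_orbit mu0]) /\
  connected (projectivization (@nilpotent_jordan R n)
               : set (proj_zariski (symbilin R n))) /\
  connected (projectivization (@nilpotent_jordan R n)
               : set (proj_classical dot)).
Proof.
(* With basis vectors numbered from 0, the only nonzero product of basis vectors is e_0 e_0 = e_1;
   this is where the dimension has to be at least 2. *)
pose phi : 'rV[R[i]]_n := delta_mx 0 (Ordinal (ltnW n_ge2)).
pose u : 'cV[R[i]]_n := delta_mx (Ordinal n_ge2) 0.
have phi0 : phi != 0.
  by apply/rV0Pn; exists (Ordinal (ltnW n_ge2)); rewrite mxE !eqxx oner_eq0.
have u0 : u != 0.
  by apply/cV0Pn; exists (Ordinal n_ge2); rewrite mxE !eqxx oner_eq0.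
have phiu : ev phi u = 0 by rewrite ev_delta mxE.
have sq0 : square phi u != 0 by rewrite square_eq0 (negbTE phi0).
have Nsq := square_nilpotent_jordan phiu.
have Asq : projectivization (@nilpotent_jordan R n) (proj_class sq0).
  by apply/proj_classP; exists (square phi u), sq0.
split; last split.
- exists (square phi u); split=> //; first by move=> Z; exact: component_square.
  rewrite gl_orbit_square //; apply/seteqP; split=> mu /=.
    (* The bound 5 is attained at [square phi u], so a maximizer has energy exactly 5 and its defect
       vanishes. *)
    move=> [mu0 maxmu]; have E5 : energy dot mu = 5.
      apply/eqP; rewrite eq_le energy_le5 //=.
      rewrite -[leLHS](energy_eq5 dot sq0).2 ?maxmu //.
      exact: square_defect_eq0 phiu (squareE _ _).
    have [psi [v [psiv sq]]] := defect_eq0_square mu0 ((energy_eq5 _ mu0).1 E5).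
    exists psi, v; move: mu0; rewrite (square_tensor_inj sq) square_eq0.
    by move=> /norP[psi0 v0]; split=> //; exact: squareE.
  move=> [psi [v [psi0 v0 psiv sq]]].
  have mu0 : mu != 0 by rewrite (square_tensor_inj sq) square_eq0 (negbTE psi0).
  split=> // nu nu0.
  by rewrite (energy_eq5 dot mu0).2 ?energy_le5 //; exact: square_defect_eq0 psiv sq.
- apply: (connected_from Asq) => _ B /proj_classP[mu [mu0 [Nmu ->]]] clop.
  apply: nilpotent_jordan_connected => // c c0 cp Nc.
  have Ac r : projectivization (@nilpotent_jordan R n) (proj_class (c0 r)).
    by apply/proj_classP; exists (c r), (c0 r).
  by split; exact: (zariski_curve _ cp Ac clop).
- apply: (connected_from Asq) => _ B /proj_classP[mu [mu0 [Nmu ->]]] clop.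
  apply: nilpotent_jordan_connected => // c c0 cp Nc.
  have Ac r : projectivization (@nilpotent_jordan R n) (proj_class (c0 r)).
    by apply/proj_classP; exists (c r), (c0 r).
  split; first exact: (classical_curve (s := 0) 1 cp Ac clop).
  exact: (classical_curve (s := 1) 0 cp Ac clop).
Qed.
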